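(* Let $S$ be a densely defined, closed, symmetric operator in a Hilbert space $\mathcal H$ and let $\{\mathcal G,\Gamma_0,\Gamma_1\}$ be a quasi boundary triple for $T\subset S^*$ with Weyl function $M$. Suppose that $A_1$ is self-adjoint and that $A_0$ and $A_1$ are bounded from below. Assume that $M(\lambda)$ is bounded for one (and hence for all) $\lambda\in\rho(A_0)$ and that there exist $\beta\in(0,1]$, $C>0$ and $\mu\le\min\sigma(A_0)$ such that $$\|\overline{M(\lambda)}\|\le\frac{C}{(\mu-\lambda)^\beta}\qquad\text{for every }\lambda<\mu.$$ Let $B$ be a closable linear operator in $\mathcal G$ and let $b\in\mathbb R$ be such that (i) $\operatorname{Re}(Bx,x)\le b\|x\|^2$ for all $x\in\operatorname{dom}B$; (ii) $\operatorname{ran}\overline{M(\lambda)}^{1/2}\subset\operatorname{dom}B$ for all $\lambda<\min\sigma(A_0)$; (iii) $B(\operatorname{ran}\overline{M(\lambda)})\subset\operatorname{ran}\Gamma_0$ for all $\lambda<\min\sigma(A_0)$; (iv) $\operatorname{ran}\Gamma_1\subset\operatorname{dom}B$. Then $A_{[B]}$ is m-sectorial and, in particular, $\sigma(A_{[B]})\subset\overline{W(A_{[B]})}$. Assume, in addition, that $\operatorname{dom}B^*\supset\operatorname{dom}B$ and that $\operatorname{Im}B$ is bounded. Then: (a) If $b>0$, then for every $\xi<\mu-(Cb)^{1/\beta}$, $$W(A_{[B]})\subset\bigl\{z\in\mathbb C:\operatorname{Re}z\ge\mu-(Cb)^{1/\beta},\ |\operatorname{Im}z|\le K_\xi(\operatorname{Re}z-\xi)^{1-\beta}\bigr\},\qquad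 K_\xi=\frac{2C\|\overline{\operatorname{Im}B}\|}{1-\frac{Cb}{(\mu-\xi)^\beta}}.$$ (b) If $b=0$, then $$W(A_{[B]})\subset\bigl\{z\in\mathbb C:\operatorname{Re}z\ge\mu,\ |\operatorname{Im}z|\le K'_\beta(\operatorname{Re}z-\mu)^{1-\beta}\bigr\},$$ where $K'_\beta=\dfrac{C\|\overline{\operatorname{Im}B}\|}{\beta^\beta(1-\beta)^{1-\beta}}$ if $0<\beta<1$ and $K'_\beta=C\|\overline{\operatorname{Im}B}\|$ if $\beta=1$, with the convention $0^0=1$ when $\beta=1$ and $\operatorname{Re}z=\mu$. Moreover, $C\|\overline{\operatorname{Im}B}\|\le K'_\beta\le2C\|\overline{\operatorname{Im}B}\|$. (c) If $b<0$, then $$W(A_{[B]})\subset\Bigl\{z\in\mathbb C:\operatorname{Re}z\ge\mu,\ |\operatorname{Im}z|\le\frac{2C\|\overline{\operatorname{Im}B}\|(\operatorname{Re}z-\mu)}{(\operatorname{Re}z-\mu)^\beta-Cb}\Bigr\}.$$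
   Context: Quasi boundary triple: let $S$ be a densely defined, closed, symmetric operator in a Hilbert space $\mathcal H$ and $T\subset S^*$ a linear operator with $\overline T=S^*$. $\{\mathcal G,\Gamma_0,\Gamma_1\}$ is a quasi boundary triple for $T\subset S^*$ if $\mathcal G$ is a Hilbert space and $\Gamma_0,\Gamma_1:\operatorname{dom}T\to\mathcal G$ are linear maps such that: (1) $(Tf,g)-(f,Tg)=(\Gamma_1f,\Gamma_0g)-(\Gamma_0f,\Gamma_1g)$ for all $f,g\in\operatorname{dom}T$; (2) $(\Gamma_0,\Gamma_1)^\top:\operatorname{dom}T\to\mathcal G\times\mathcal G$ has dense range; (3) $A_0:=T\upharpoonright\ker\Gamma_0$ is self-adjoint in $\mathcal H$. Put $A_1:=T\upharpoonright\ker\Gamma_1$ (symmetric, not necessarily self-adjoint). For $\lambda\in\rho(A_0)$, $\Gamma_0\upharpoonright\ker(T-\lambda)$ is injective. The Weyl function is $M(\lambda)=\Gamma_1(\Gamma_0\upharpoonright\ker(T-\lambda))^{-1}$, defined on the dense subspace $\operatorname{ran}\Gamma_0$ of $\mathcal G$; it is closable and $\overline{M(\lambda)}$ is its closure. Under the decay assumption, $\overline{M(\lambda)}$ is a bounded self-adjoint non-negative operator for all real $\lambda<\min\sigma(A_0)$ (so its square root is defined). For a linear operator $B$ in $\mathcal G$: $A_{[B]}f=Tf$, $\operatorname{dom}A_{[B]}=\{f\in\operatorname{dom}T:\Gamma_1f\in\operatorname{dom}B,\ \Gamma_0f=B\Gamma_1f\}$. $\operatorname{Im}B=\frac1{2i}(B-B^*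 )$ (defined on $\operatorname{dom}B\cap\operatorname{dom}B^*$; $B$ is densely defined by (iv)), and $\overline{\operatorname{Im}B}$ is its closure. Numerical range: $W(A)=\{(Af,f):f\in\operatorname{dom}A,\|f\|=1\}$. $A$ is m-sectorial if $W(A)$ is contained in a sector $\{z:\operatorname{Re}z\ge\eta,|\operatorname{Im}z|\le\kappa(\operatorname{Re}z-\eta)\}$ with $\eta\in\mathbb R$, $\kappa>0$, whose complement has non-trivial intersection with $\rho(A)$. *)

(* Defs.v *)
From HB Require Import structures.
From mathcomp Require Import all_boot all_order all_algebra.
From mathcomp Require Import sesquilinear complex.
From mathcomp Require Import all_classical all_reals all_analysis.

Set Implicit Arguments.
Unset Strict Implicit.
Unset Printing Implicit Defensive.

Import Order.TTheory GRing.Theory Num.Theory.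
Import numFieldNormedType.Exports.

Local Open Scope classical_set_scope.
Local Open Scope complex_scope.
Local Open Scope ring_scope.

(* The inner product is linear in the first and antilinear in the second
   argument. *)
HB.mixin Record NormedModule_isHilbert (R : realType) H
    & CompleteNormedModule R[i] H := {
  inner : {dot H for (@Num.conj R[i])} ;
  normr_inner : forall x : H, `|x| ^+ 2 = inner x x }.

#[short(type="hilbertType")]
HB.structure Definition Hilbert (R : realType) :=
  {H of CompleteNormedModule R[i] H & NormedModule_isHilbert R H}.

Notation "''[' x , y ]" := (inner x y) : ring_scope.

(* The norm of a normed R[i]-module takes values in R[i]; this is the same norm
   as an element of R. *)
Definition rnorm {R : realType} {V : normedModType R[i]} (x : V) : R :=
  complex.Re `|x|.

Section Operators.
Variable R : realType.

(* A partially defined map; the values of app outside dom are irrelevant. *)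
Record op (U V : Type) := Op { dom : set U ; app :> U -> V }.

HB.instance Definition _ U V := gen_eqMixin (op U V).
HB.instance Definition _ U V := gen_choiceMixin (op U V).

Definition graph U V (A : op U V) : set (U * V) :=
  [set p | dom A p.1 /\ p.2 = A p.1].

Definition eqop U V (A B : op U V) : Prop := graph A = graph B.

Definition subop U V (A B : op U V) : Prop := graph A `<=` graph B.

Definition ran U V (A : op U V) : set V := A @` dom A.

Definition img U V (A : op U V) (X : set U) : set V := A @` (X `&` dom A).

Definition restrict_op U V (A : op U V) (D : set U) : op U V :=
  Op (dom A `&` D) A.

Definition comp_op U V W (A : op V W) (B : op U V) : op U W :=
  Op (dom B `&` B @^-1` dom A) (A \o B).

Definition linear_on (U V : lmodType R[i]) (D : set U) (f : U -> V) : Prop :=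
  D 0 /\ forall (a : R[i]) x y, D x -> D y ->
    D (a *: x + y) /\ f (a *: x + y) = a *: f x + f y.

Definition linear_op (U V : lmodType R[i]) (A : op U V) : Prop :=
  linear_on (dom A) A.

Section Normed.
Variables U V : normedModType R[i].

Definition densely_defined (A : op U V) : Prop := dense (dom A).

Definition closed_op (A : op U V) : Prop := closed (graph A).

Definition closable (A : op U V) : Prop :=
  forall y : V, closure (graph A) (0, y) -> y = 0.

(* Only meaningful when A is closable: closure (graph A) is then the graph of
   an operator. *)
Definition closure_op (A : op U V) : op U V :=
  Op [set x | exists y, closure (graph A) (x, y)]
     (fun x => xget 0 [set y | closure (graph A) (x, y)]).

Definition bounded_op (A : op U V) : Prop :=
  exists c : R, forall x, dom A x -> rnorm (A x) <= c * rnorm x.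

Definition opnorm (A : op U V) : \bar R :=
  ereal_sup [set (rnorm (A x))%:E | x in dom A `&` [set x | rnorm x <= 1]].

End Normed.

Definition resolvent_set (H : normedModType R[i]) (A : op H H) : set R[i] :=
  [set l | set_bij (dom A) setT (fun x => A x - l *: x) /\
           exists c : R, forall x, dom A x ->
             rnorm x <= c * rnorm (A x - l *: x)].

Definition spectrum (H : normedModType R[i]) (A : op H H) : set R[i] :=
  ~` resolvent_set A.

(* Meant for A self-adjoint and bounded from below: the spectrum is then real
   and closed, and the infimum is a minimum (it is +oo when H is trivial, the
   spectrum being empty only in that case). *)
Definition min_spectrum (H : normedModType R[i]) (A : op H H) : \bar R :=
  ereal_inf [set s%:E | s in [set s : R | spectrum A s%:C]].

Section Hilbert.
Variables H G : hilbertType R.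

(* Only meaningful when A is densely defined: z is then determined by y. *)
Definition adjoint (A : op H G) : op G H :=
  Op [set y | exists z, forall x, dom A x -> '[A x, y] = '[x, z]]
     (fun y => xget 0 [set z | forall x, dom A x -> '[A x, y] = '[x, z]]).

Definition symmetric_op (A : op H H) : Prop :=
  forall x y, dom A x -> dom A y -> '[A x, y] = '[x, A y].

(* An inequality in R[i] between c%:C and z says in particular that z is real. *)
Definition bounded_from_below (A : op H H) : Prop :=
  exists c : R, forall x, dom A x -> c%:C * '[x, x] <= '[A x, x].

Definition nonnegative_op (A : op H H) : Prop :=
  forall x, dom A x -> 0 <= '[A x, x].

Definition numerical_range (A : op H H) : set R[i] :=
  [set '[A x, x] | x in dom A `&` [set x | rnorm x = 1]].

End Hilbert.

Definition self_adjoint (H : hilbertType R) (A : op H H) : Prop :=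
  densely_defined A /\ eqop A (adjoint A).

(* For A self-adjoint and non-negative there is exactly one such Q up to eqop;
   the default value A is then never used. *)
Definition sqrt_op (H : hilbertType R) (A : op H H) : op H H :=
  xget A [set Q | [/\ self_adjoint Q, nonnegative_op Q & eqop (comp_op Q Q) A]].

Definition Im_op (H : hilbertType R) (B : op H H) : op H H :=
  Op (dom B `&` dom (adjoint B))
     (fun x => (2%:R * 'i)^-1 *: (B x - adjoint B x)).

Definition sector (eta kappa : R) : set R[i] :=
  [set z | eta <= complex.Re z /\
           `|complex.Im z| <= kappa * (complex.Re z - eta)].

Definition m_sectorial (H : hilbertType R) (A : op H H) : Prop :=
  exists eta kappa : R,
    [/\ 0 < kappa, numerical_range A `<=` sector eta kappa
      & ~` sector eta kappa `&` resolvent_set A !=set0].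

Section Triples.
Variables H G : hilbertType R.
Variables (T : op H H) (G0 G1 : H -> G).

Definition ker_restrict (f : H -> G) : op H H :=
  restrict_op T [set x | f x = 0].

Record quasi_boundary_triple (S : op H H) : Prop := QuasiBoundaryTriple {
  qbt_linear : linear_op T ;
  qbt_sub : subop T (adjoint S) ;
  qbt_closure : eqop (closure_op T) (adjoint S) ;
  qbt_linear0 : linear_on (dom T) G0 ;
  qbt_linear1 : linear_on (dom T) G1 ;
  qbt_green : forall f g, dom T f -> dom T g ->
    '[T f, g] - '[f, T g] = '[G1 f, G0 g] - '[G0 f, G1 g] ;
  qbt_dense : dense [set (G0 f, G1 f) | f in dom T] ;
  qbt_selfadj : self_adjoint (ker_restrict G0) }.

Definition eigen_ker (l : R[i]) : set H := [set f | dom T f /\ T f = l *: f].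

(* Meaningful for l in the resolvent set of A_0, where G0 is injective on
   eigen_ker l. *)
Definition weyl (l : R[i]) : op G G :=
  Op (G0 @` eigen_ker l)
     (fun phi => G1 (xget 0 [set f | eigen_ker l f /\ G0 f = phi])).

Definition robin_op (B : op G G) : op H H :=
  restrict_op T [set f | dom B (G1 f) /\ G0 f = B (G1 f)].

End Triples.

End Operators.

(* Main.v *)
Require Import Defs.
From mathcomp Require Import all_boot all_order all_algebra.
From mathcomp Require Import sesquilinear complex.
From mathcomp Require Import all_classical all_reals all_analysis.
From mathcomp Require Import ring lra.
Import Order.TTheory GRing.Theory Num.Theory.
Import numFieldNormedType.Exports.
Local Open Scope classical_set_scope.
Local Open Scope complex_scope.
Local Open Scope ring_scope.

Set Implicit Arguments.
Unset Strict Implicit.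
Unset Printing Implicit Defensive.

(** The form [a_l f = Re ((T - l) f, f) + Re (G0 f, G1 f)] is non-negative on
[dom T] for every real [l < mu]: splitting [f] into an element of [dom A0] and an
element of [ker (T - nu)], one bounds [a_l f] from below by terms which vanish
as [nu -> -oo], because [M(nu)] decays. By duality with [ker (T - l)] this gives
[|G1 f|^2 <= |M(l)| a_l f]. On [dom A_[B]], with [x = G1 f], the form is
[Re ((A_[B] - l) f, f) + Re (B x, x)], while [Im (A_[B] f, f) = - Im (B x, x)],
so each enclosure comes from a suitable choice of [l].

For m-sectoriality take [l] real and very negative. With [Q] the square root
of the closure of [M(l)], [B Q] is bounded by the closed graph theorem. Since
[l] is also in the resolvent set of [A1], [G1 f = M(l) phi = Q (Q phi)] with
[|Q phi|^2 <= a_l f], which controls [Im (B x, x)]; and [A_[B] - l] is onto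
because [1 - Q B Q] is coercive. Finally the numerical range is convex
(Toeplitz-Hausdorff), so a point off its closure is separated from it by a line,
and surjectivity propagates within each half-plane that misses the numerical
range. *)

(** [G0] and [G1] need be neither bounded nor onto, and [B] may be unbounded; this shapes both
    halves of the proof. The bound on [G1 f] asks for a test element of [ker (T - l)] with boundary
    value [G1 f / K], where [K] bounds [M(l)]; such an element may not exist, and density of
    [ran G0] replaces it. Sectoriality needs exact preimages, because [|x|^2] does not control
    [(B x, x)]: only after writing [x = Q h] can the bounded operator [B Q] act. Hypothesis (iii)
    then leads from a solution in [G] back to the boundary value of an element of [dom T].

    The enclosures come from one family of real inequalities. For a unit vector [f], with
    [X = |G1 f|^2] and [r = Re (A_[B] f, f)], one has [X (mu - l)^beta <= C (r - l + b X)] for all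
    [l < mu]. Apart from limiting cases such as [r = mu], the choices are [l = 2 xi - r] when
    [b > 0], [l = 2 mu - r] when [b < 0], and when [b = 0] the minimiser of
    [(r - l) / (mu - l)^beta], whence the constant [beta^beta (1 - beta)^(1 - beta)]. *)

Section Norm.
Variables (R : realType) (V : normedModType R[i]).
Implicit Types x y : V.

Lemma rnormE x : `|x| = (rnorm x)%:C.
Proof.
by rewrite /rnorm RRe_real//; exact: normr_real.
Qed.

Lemma rnorm_ge0 x : 0 <= rnorm x.
Proof. by rewrite -ler0c -rnormE. Qed.

Lemma rnorm0 : rnorm (0 : V) = 0.
Proof. by rewrite /rnorm normr0. Qed.

Lemma rnorm_eq0 x : rnorm x = 0 -> x = 0.
Proof. by move=> x0; apply/normr0_eq0; rewrite rnormE x0. Qed.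

Lemma rnorm_gt0 x : x != 0 -> 0 < rnorm x.
Proof.
move=> x0; rewrite lt_neqAle rnorm_ge0 andbT eq_sym.
by apply: contra x0 => /eqP /rnorm_eq0 ->.
Qed.

Lemma rnormN x : rnorm (- x) = rnorm x.
Proof. by rewrite /rnorm normrN. Qed.

Lemma rnormB x y : rnorm (x - y) = rnorm (y - x).
Proof. by rewrite -rnormN opprB. Qed.

Lemma ler_rnormD x y : rnorm (x + y) <= rnorm x + rnorm y.
Proof. by rewrite -lecR rmorphD/= -!rnormE ler_normD. Qed.

Lemma ler_rnormDist z x y : rnorm (x - y) <= rnorm (x - z) + rnorm (z - y).
Proof.
apply: le_trans (ler_rnormD _ _); rewrite addrA subrK; exact: lexx.
Qed.

Lemma rnormZ a x : rnorm (a *: x) = rnorm (a : R[i]^o) * rnorm x.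
Proof.
by apply: complexI; rewrite rmorphM/= -!rnormE normrZ.
Qed.

Lemma rnormZr (t : R) x : rnorm (t%:C *: x) = `|t| * rnorm x.
Proof.
rewrite rnormZ; congr (_ * _).
by rewrite /rnorm normc_def/= expr0n/= addr0 sqrtr_sqr.
Qed.

Lemma rnormZi x : rnorm ('i *: x) = rnorm x.
Proof.
rewrite rnormZ -[RHS]mul1r; congr (_ * _).
by rewrite /rnorm normc_def/= expr0n/= add0r expr1n sqrtr1.
Qed.

Lemma nbhs_rnorm x (A : set V) :
  nbhs x A <-> exists2 e : R, 0 < e & forall y, rnorm (x - y) < e -> A y.
Proof.
split=> [/nbhs_normP[e /= e0 eA]|[e e0 eA]]; last apply/nbhs_normP.
  have er : e = (complex.Re e)%:C by rewrite RRe_real// gtr0_real.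
  exists (complex.Re e); first by move: e0; rewrite er ltcR.
  by move=> y xy; apply: eA => /=; rewrite er rnormE ltcR.
exists e%:C; first by rewrite /= ltcR.
by move=> y /=; rewrite rnormE ltcR; exact: eA.
Qed.

Lemma closureP (A : set V) x :
  closure A x <-> forall e : R, 0 < e -> exists2 y, A y & rnorm (x - y) < e.
Proof.
split=> [clA e e0|clA B].
  have /clA[y [Ay xy]] : nbhs x [set y | rnorm (x - y) < e].
    by apply/nbhs_rnorm; exists e.
  by exists y.
move=> /nbhs_rnorm[e e0 eB]; have [y Ay xy] := clA _ e0.
by exists y; split => //; exact: eB.
Qed.

Lemma dense_rnormP (A : set V) : dense A <->
  forall x (e : R), 0 < e -> exists2 y, A y & rnorm (x - y) < e.
Proof.
split=> [dA x e e0|dA O [x Ox] oO].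
  have /dA[] : [set y | rnorm (x - y) < e] !=set0.
    by exists x => /=; rewrite subrr rnorm0.
    rewrite openE => y /= xy; apply/nbhs_rnorm; exists (e - rnorm (x - y)).
      by rewrite subr_gt0.
    move=> z yz; apply: le_lt_trans (ler_rnormDist y _ _) _; lra.
  by move=> y [/= xy Ay]; exists y.
have /nbhs_rnorm[e e0 eO] : nbhs x O by move: oO; rewrite openE => /(_ _ Ox).
by have [y Ay xy] := dA x e e0; exists y; split => //; exact: eO.
Qed.

End Norm.

(** * Closures of graphs and dense sets of pairs, in epsilon form *)

Section Product.
Variables (R : realType) (U V : normedModType R[i]).

Lemma closure_graphP (A : op U V) x y : closure (graph A) (x, y) <->
  forall e : R, 0 < e -> exists u, [/\ dom A u, rnorm (x - u) < e
    & rnorm (y - A u) < e].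
Proof.
split=> [clA e e0|clA B].
  have : nbhs (x, y) [set p | rnorm (x - p.1) < e /\ rnorm (y - p.2) < e].
    exists ([set u | rnorm (x - u) < e], [set v | rnorm (y - v) < e]).
      by split; apply/nbhs_rnorm; exists e.
    by move=> [u v] [].
  by move=> /clA[[u v] [[/= Au ->] [xu yv]]]; exists u.
move=> [[C D] /= [/nbhs_rnorm[c c0 cC] /nbhs_rnorm[d d0 dD]] CDB].
have [|u [Au xu yu]] := clA (Num.min c d); first by rewrite lt_min c0.
exists (u, A u); split; first by split.
apply: CDB; split=> /=.
  by apply: cC; apply: lt_le_trans xu _; rewrite ge_min lexx.
by apply: dD; apply: lt_le_trans yu _; rewrite ge_min lexx orbT.
Qed.

Lemma dense_pairP (X : set (U * V)) : dense X ->
  forall x y (e : R), 0 < e -> exists2 p, X p & rnorm (x - p.1) < e /\ rnorm (y - p.2) < e.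
Proof.
move=> dX x y e e0.
have oU (W : normedModType R[i]) (w : W) : open_nbhs w [set v | rnorm (w - v) < e].
  split; last by rewrite /= subrr rnorm0.
  rewrite openE => v /= wv; apply/nbhs_rnorm; exists (e - rnorm (w - v)).
    by rewrite subr_gt0.
  move=> z yz; apply: le_lt_trans (ler_rnormDist v _ _) _; lra.
have [oA Ax] := oU _ x; have [oB By] := oU _ y.
have := dX ([set v | rnorm (x - v) < e] `*` [set v | rnorm (y - v) < e]).
case; first by exists (x, y).
  rewrite openE => -[u v] [/= xu yv].
  exists ([set v | rnorm (x - v) < e], [set v | rnorm (y - v) < e]) => //.
  by split; [move: oA | move: oB]; rewrite openE; apply.
by move=> p [[? ?] ?]; exists p.
Qed.

End Product.

(** * Completeness *)

Section Complete.
Variables (R : realType) (V : completeNormedModType R[i]).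

Lemma rnorm_complete (u : nat -> V) :
  (forall e : R, 0 < e -> exists N, forall m n, (N <= m)%N -> (N <= n)%N ->
    rnorm (u m - u n) < e) ->
  exists l, forall e : R, 0 < e -> exists N, forall n, (N <= n)%N ->
    rnorm (u n - l) < e.
Proof.
move=> cu.
have /cauchy_cvgP/cvg_ex[l ul] : cauchy (u @ \oo).
  apply/cauchy_ballP => e e0.
  have er : e = (complex.Re e)%:C by rewrite RRe_real// gtr0_real.
  have [|N uN] := cu (complex.Re e); first by move: e0; rewrite er ltcR.
  exists (u @` [set n | (N <= n)%N], u @` [set n | (N <= n)%N]).
    by split; exists N => // n Nn; exists n.
  move=> [_ _] [/= [m Nm <-] [n Nn <-]].
  by rewrite -ball_normE /ball_/= rnormE er ltcR; exact: uN.
exists l => e e0.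
have : nbhs l [set y | rnorm (y - l) < e].
  by apply/nbhs_rnorm; exists e => // y; rewrite rnormB.
by move=> /ul[N _ uN]; exists N => n Nn; exact: uN.
Qed.

(** The increments of [u] are majorised by those of a bounded real sequence, so [u] is Cauchy and
    its limit inherits the majorant. The explicit error [L - s n] serves the contraction principle,
    the root iteration, the nested balls and the closed graph series alike. *)
Lemma dominated_complete (u : nat -> V) (s : nat -> R) (M : R) :
  (forall n, rnorm (u n.+1 - u n) <= s n.+1 - s n) -> (forall n, s n <= M) ->
  exists l L, (forall n, rnorm (l - u n) <= L - s n) /\
    (forall e, 0 < e -> exists N, forall n, (N <= n)%N -> L - s n < e).
Proof.
move=> us sM.
have sS n : s n <= s n.+1 by rewrite -subr_ge0; apply: le_trans (rnorm_ge0 _) (us n).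
have sm : {homo s : m n / (m <= n)%N >-> m <= n} by apply/nondecreasing_seqP.
have umn m k : rnorm (u (m + k)%N - u m) <= s (m + k)%N - s m.
  elim: k => [|k IH]; first by rewrite addn0 !subrr rnorm0.
  rewrite addnS; apply: le_trans (ler_rnormDist (u (m + k)%N) _ _) _.
  by have := us (m + k)%N; lra.
have sS' : has_sup (range s).
  by split; [exists (s 0%N), 0%N | exists M => _ [n _ <-]].
pose L := sup (range s).
have sL n : s n <= L by apply: sup_upper_bound => //; exists n.
have Ls e : 0 < e -> exists N, forall n, (N <= n)%N -> L - s n < e.
  move=> e0; have [_ [N _ <-] LN] := sup_adherent e0 sS'.
  by exists N => n /sm; rewrite -/L in LN *; lra.
have [l ul] : exists l, forall e : R, 0 < e -> exists N, forall n, (N <= n)%N ->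
    rnorm (u n - l) < e.
  apply: rnorm_complete => e e0; have [N LN] := Ls _ e0; exists N => m n Nm Nn.
  wlog nm : m n Nm Nn / (n <= m)%N.
    move=> W; have [|/ltnW] := leqP n m; first exact: W.
    by rewrite rnormB; exact: W.
  rewrite -(subnKC nm); apply: le_lt_trans (umn _ _) _.
  by have := LN n Nn; have := sL (n + (m - n))%N; lra.
exists l, L; split=> // n; apply/ler_addgt0Pr => e e0.
have [N uN] := ul _ e0; have := uN (n + N)%N (leq_addl _ _) => uNl.
apply: le_trans (ler_rnormDist (u (n + N)%N) _ _) _.
rewrite rnormB; have := umn n N; have := sL (n + N)%N; lra.
Qed.

End Complete.

Lemma invS_small (R : realType) (e : R) : 0 < e ->
  exists N : nat, forall n, (N <= n)%N -> n.+1%:R^-1 < e.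
Proof.
move=> e0; have [N Ne] := ltr_add_invr e0; exists N => n Nn.
rewrite add0r in Ne; apply: le_lt_trans Ne.
by rewrite lef_pV2 ?posrE// ler_nat ltnS.
Qed.

(* The real inner product carries all the information, because
   [Im '[x, y] = rip x (i y)]. *)
Definition rip (R : realType) (V : hilbertType R) (x y : V) : R :=
  complex.Re '[x, y].

(** * The real inner product and Cauchy-Schwarz *)

Section InnerProduct.
Variables (R : realType) (V : hilbertType R).
Implicit Types (x y z : V) (t : R).

Lemma innerDl x y z : '[x + y, z] = '[x, z] + '[y, z].
Proof. exact: linearDl. Qed.

Lemma innerDr x y z : '[x, y + z] = '[x, y] + '[x, z].
Proof. exact: linearDr. Qed.

Lemma innerBl x y z : '[x - y, z] = '[x, z] - '[y, z].
Proof. exact: linearBl. Qed.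

Lemma innerBr x y z : '[x, y - z] = '[x, y] - '[x, z].
Proof. exact: linearBr. Qed.

Lemma innerZl a x y : '[a *: x, y] = a * '[x, y].
Proof. exact: linearZl_LR. Qed.

Lemma innerC x y : '[x, y] = ('[y, x])^*%C.
Proof. by rewrite (hermC (@inner R V)) expr0 mul1r. Qed.

Lemma innerZr a x y : '[x, a *: y] = a^*%C * '[x, y].
Proof. by rewrite innerC innerZl rmorphM/= -innerC. Qed.

Lemma ripDl x y z : rip (x + y) z = rip x z + rip y z.
Proof. by rewrite /rip innerDl raddfD. Qed.

Lemma ripDr x y z : rip x (y + z) = rip x y + rip x z.
Proof. by rewrite /rip innerDr raddfD. Qed.

Lemma ripZl t x y : rip (t%:C *: x) y = t * rip x y.
Proof. by rewrite /rip innerZl; case: '[x, y] => a b /=; rewrite mul0r subr0. Qed.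

Lemma ripC x y : rip x y = rip y x.
Proof. by rewrite /rip innerC; case: '[y, x]. Qed.

Lemma ripZr t x y : rip x (t%:C *: y) = t * rip x y.
Proof. by rewrite ripC ripZl ripC. Qed.

Lemma ripNl x y : rip (- x) y = - rip x y.
Proof. by rewrite -scaleN1r (_ : -1 = (-1)%:C) ?ripZl ?mulN1r// rmorphN1. Qed.

Lemma ripNr x y : rip x (- y) = - rip x y.
Proof. by rewrite ripC ripNl ripC. Qed.

Lemma ripBl x y z : rip (x - y) z = rip x z - rip y z.
Proof. by rewrite ripDl ripNl. Qed.

Lemma ripBr x y z : rip x (y - z) = rip x y - rip x z.
Proof. by rewrite ripDr ripNr. Qed.

Lemma rip0l x : rip 0 x = 0.
Proof. by rewrite -(subrr x) ripBl subrr. Qed.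

Lemma rip0r x : rip x 0 = 0.
Proof. by rewrite ripC rip0l. Qed.

Lemma ripxx x : rip x x = rnorm x ^+ 2.
Proof.
by apply: complexI; rewrite rmorphXn/= -rnormE normr_inner /rip RRe_real// ger0_real.
Qed.

Lemma innerxx x : '[x, x] = (rnorm x ^+ 2)%:C.
Proof. by rewrite -normr_inner rnormE rmorphXn. Qed.

Lemma ripZi x y : rip ('i *: x) y = - rip x ('i *: y).
Proof.
rewrite /rip innerZl innerZr; case: '[x, y] => a b /=; ring.
Qed.

Lemma Im_inner x y : complex.Im '[x, y] = rip x ('i *: y).
Proof.
rewrite /rip innerZr; case: '[x, y] => a b /=; ring.
Qed.

Lemma innerE x y : '[x, y] = (rip x y) +i* (rip x ('i *: y)).
Proof. by rewrite -Im_inner /rip; case: '[x, y]. Qed.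

Definition ripE := (ripDl, ripDr, ripNl, ripNr, ripZl, ripZr).

Lemma rnormD_sqr x y : rnorm (x + y) ^+ 2 = rnorm x ^+ 2 + 2 * rip x y + rnorm y ^+ 2.
Proof. rewrite -!ripxx !ripE (ripC y x); ring. Qed.

Lemma rnormB_sqr x y : rnorm (x - y) ^+ 2 = rnorm x ^+ 2 - 2 * rip x y + rnorm y ^+ 2.
Proof. rewrite -!ripxx !ripE (ripC y x); ring. Qed.

(** Pairing both sides with an arbitrary [z] turns a vector identity into a scalar one, which [ring]
    can settle. *)
Lemma rip_ext x y : (forall z, rip x z = rip y z) -> x = y.
Proof.
move=> xy; apply/eqP; rewrite -subr_eq0; apply/eqP/rnorm_eq0/eqP.
by rewrite -sqrf_eq0 -ripxx ripBl xy subrr.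
Qed.

(** The discriminant criterion behind the Cauchy-Schwarz inequalities below. Some of the forms are
    only semidefinite, so [c = 0] must be covered. *)
Lemma sqr_le_of_quadratic (a b c : R) : 0 <= c ->
  (forall t : R, 0 <= a + 2 * t * b + t ^+ 2 * c) -> b ^+ 2 <= a * c.
Proof.
rewrite le_eqVlt => /predU1P[<- H|c0 H].
  have [->|b0] := eqVneq b 0; first by rewrite expr0n/= mulr0.
  have := H (- (a + 1) / (2 * b)).
  have -> : 2 * (- (a + 1) / (2 * b)) * b = - (a + 1) by field; rewrite b0.
  by rewrite mulr0; lra.
have := H (- (b / c)).
have -> : a + 2 * - (b / c) * b + (- (b / c)) ^+ 2 * c = (a * c - b ^+ 2) / c.
  by field; rewrite gt_eqF.
by rewrite pmulr_lge0 ?invr_gt0// subr_ge0.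
Qed.

Lemma rip_sqr_le x y : rip x y ^+ 2 <= rnorm x ^+ 2 * rnorm y ^+ 2.
Proof.
apply: sqr_le_of_quadratic => [|t]; first exact: sqr_ge0.
have := sqr_ge0 (rnorm (x + t%:C *: y)).
by rewrite rnormD_sqr rnormZr ripZr exprMn real_normK ?num_real// mulrA.
Qed.

Lemma rip_norm_le x y : `|rip x y| <= rnorm x * rnorm y.
Proof.
rewrite -(ler_pXn2r (ltn0Sn 1)) ?nnegrE// ?mulr_ge0 ?rnorm_ge0//.
by rewrite real_normK ?num_real// exprMn rip_sqr_le.
Qed.

Lemma rip_le x y : rip x y <= rnorm x * rnorm y.
Proof. exact: le_trans (ler_norm _) (rip_norm_le _ _). Qed.

Lemma rip_geN x y : - (rnorm x * rnorm y) <= rip x y.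
Proof. by have := rip_norm_le x y; rewrite ler_norml => /andP[]. Qed.

Lemma dense_rip0 (D : set V) x : dense D -> (forall y, D y -> rip x y = 0) -> x = 0.
Proof.
move=> /dense_rnormP dD xD; apply: rnorm_eq0; apply/eqP/negPn/negP => x0.
have x1 : 0 < rnorm x by rewrite lt_neqAle eq_sym x0 rnorm_ge0.
have [y /xD xy] := dD x _ x1.
rewrite -(ltr_pXn2r (ltn0Sn 1)) ?nnegrE// ?rnorm_ge0// rnormB_sqr xy.
by have := sqr_ge0 (rnorm y); lra.
Qed.

End InnerProduct.

Lemma inner_eqP (R : realType) (U V : hilbertType R) (x y : U) (x' y' : V) :
  rip x y = rip x' y' -> rip x ('i *: y) = rip x' ('i *: y') ->
  '[x, y] = '[x', y'].
Proof. by rewrite !innerE => -> ->. Qed.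

(** * Projection onto closed convex sets and closed subspaces *)

Section Projection.
Variables (R : realType) (V : hilbertType R).

(* A minimizing sequence is Cauchy by the parallelogram identity. *)
Lemma convex_projection (X : set V) : X !=set0 ->
  (forall x y (t : R), X x -> X y -> 0 <= t -> t <= 1 ->
    X (x + t%:C *: (y - x))) ->
  (forall p, (forall e : R, 0 < e -> exists2 x, X x & rnorm (p - x) < e) -> X p) ->
  forall v, exists2 p, X p & forall x, X x -> rip (x - p) (v - p) <= 0.
Proof.
move=> [x0 Xx0] cX clX v.
pose E := [set rnorm (v - x) | x in X].
have hE : has_inf E.
  by split; [exists (rnorm (v - x0)), x0 | exists 0 => _ [x _ <-]; exact: rnorm_ge0].
pose d := inf E.
have d0 : 0 <= d by apply: lb_le_inf; [exact: hE.1 | move=> _ [x _ <-]; exact: rnorm_ge0].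
have dX x : X x -> d <= rnorm (v - x) by move=> Xx; apply: ge_inf; [exact: hE.2 | exists x].
have dX2 x : X x -> d ^+ 2 <= rnorm (v - x) ^+ 2.
  by move=> Xx; rewrite ler_pXn2r ?nnegrE ?rnorm_ge0 ?dX.
have ap e : 0 < e -> exists2 x, X x & rnorm (v - x) ^+ 2 < d ^+ 2 + e.
  (* As [k <= 1], [(d + k)^2 <= d^2 + k (2 d + 1)], which is below [d^2 + e]. *)
  move=> e0; pose k := Num.min 1 (e / (2 * d + 2)).
  have k0 : 0 < k by rewrite lt_min ltr01 divr_gt0//; lra.
  have [_ [x Xx <-] xd] := inf_adherent k0 hE.
  exists x => //; rewrite -/d in xd.
  have k1 : k <= 1 by rewrite ge_min lexx.
  have k2 : k * (2 * d + 2) <= e by rewrite -ler_pdivlMr ?ge_min ?lexx ?orbT//; lra.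
  have := rnorm_ge0 (v - x); nra.
have par x y e : X x -> X y -> rnorm (v - x) ^+ 2 < d ^+ 2 + e ->
    rnorm (v - y) ^+ 2 < d ^+ 2 + e -> rnorm (x - y) ^+ 2 < 4 * e.
  move=> Xx Xy xe ye.
  have i0 : 0 <= 2^-1 :> R by lra.
  have i1 : 2^-1 <= 1 :> R by lra.
  have := dX2 _ (cX x y (2^-1) Xx Xy i0 i1).
  have -> : v - (x + (2^-1)%:C *: (y - x)) = (v - x) - (2^-1)%:C *: ((v - x) - (v - y)).
    by apply: rip_ext => z; rewrite !ripE; ring.
  have -> : x - y = (v - y) - (v - x).
    by apply: rip_ext => z; rewrite !ripE; ring.
  move: xe ye; move: (v - x) (v - y) => a c xe ye.
  by rewrite !rnormB_sqr rnormZr ripZr exprMn ger0_norm// rnormB_sqr ripBr ripxx (ripC c); lra.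
have /choice[u uP] : forall n : nat, exists x, X x /\ rnorm (v - x) ^+ 2 < d ^+ 2 + n.+1%:R^-1.
  by move=> n; have [|x Xx xn] := ap n.+1%:R^-1; [rewrite invr_gt0| exists x].
have small e : 0 < e -> exists N : nat, forall n, (N <= n)%N -> n.+1%:R^-1 < e :> R.
  by move=> e0; exact: invS_small.
have [l ul] : exists l, forall e : R, 0 < e -> exists N, forall n, (N <= n)%N ->
    rnorm (u n - l) < e.
  apply: rnorm_complete => e e0.
  have [|N sN] := small (e ^+ 2 / 4); first by rewrite divr_gt0// exprn_gt0.
  exists N => m n Nm Nn; rewrite -(ltr_pXn2r (ltn0Sn 1)) ?nnegrE ?rnorm_ge0 ?(ltW e0)//.
  have [[Xm um] [Xn un]] := (uP m, uP n).
  have -> : e ^+ 2 = 4 * (e ^+ 2 / 4) by field.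
  apply: par => //; first by apply: lt_trans um _; rewrite ltrD2l sN.
  by apply: lt_trans un _; rewrite ltrD2l sN.
have Xl : X l.
  by apply: clX => e /ul[N /(_ N (leqnn _)) uN]; exists (u N); [exact: (uP N).1|rewrite rnormB].
have ld : rnorm (v - l) <= d.
  apply/ler_addgt0Pr => e e0.
  have [N1 uN] := ul (e / 2) (divr_gt0 e0 (ltr0n _ 2)).
  have [|N2 sN] := small ((e / 2) ^+ 2); first by rewrite exprn_gt0// divr_gt0.
  pose n := maxn N1 N2.
  have un := uN n (leq_maxl _ _).
  have := lt_trans (uP n).2 (_ : _ < d ^+ 2 + (e / 2) ^+ 2).
  rewrite ltrD2l => /(_ (sN n (leq_maxr _ _))) vn.
  apply: le_trans (ler_rnormDist (u n) _ _) _.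
  suff : rnorm (v - u n) <= d + e / 2 by lra.
  rewrite -(ler_pXn2r (ltn0Sn 1)) ?nnegrE ?rnorm_ge0//; last by rewrite addr_ge0// divr_ge0// ltW.
  by have e2 : 0 < e / 2 by [rewrite divr_gt0]; nra.
exists l => // x Xx.
have H (t : R) : 0 <= t -> t <= 1 -> 2 * t * rip (x - l) (v - l) <= t ^+ 2 * rnorm (x - l) ^+ 2.
  move=> t0 t1; have := dX2 _ (cX l x t Xl Xx t0 t1).
  have : rnorm (v - l) ^+ 2 <= d ^+ 2 by rewrite ler_pXn2r ?nnegrE ?rnorm_ge0.
  rewrite opprD addrA; move: (v - l) (x - l) => a c.
  rewrite rnormB_sqr rnormZr ripZr exprMn real_normK ?num_real// (ripC a); lra.
rewrite leNgt; apply/negP => r0.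
pose k := rnorm (x - l) ^+ 2; pose r := rip (x - l) (v - l).
have k0 : 0 <= k by exact: sqr_ge0.
have rk : 0 < r + k by rewrite ltr_wpDr.
(* If [r] were positive, this admissible step length would give [t k < r < 2 r], against [H]. *)
pose t := r / (r + k).
have t0 : 0 < t by rewrite divr_gt0.
have tk : t * (r + k) = r by rewrite /t divfK ?gt_eqF.
have t1 : t <= 1 by rewrite ler_pdivrMr// mul1r lerDl.
have := H t (ltW t0) t1; rewrite -/r -/k.
have -> : 2 * t * r = t * (2 * r) by ring.
have -> : t ^+ 2 * k = t * (t * k) by ring.
rewrite ler_pM2l// leNgt => /negP; apply.
have : 0 < t * r by rewrite mulr_gt0.
by move: tk; rewrite mulrDr; lra.
Qed.

(* Orthogonality follows by testing the variational inequality with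
   [p +/- x] and, for the imaginary part, [p +/- i x]. *)
Lemma subspace_projection (X : set V) :
  X 0 -> (forall (a : R[i]) x y, X x -> X y -> X (a *: x + y)) ->
  (forall p, (forall e : R, 0 < e -> exists2 x, X x & rnorm (p - x) < e) -> X p) ->
  forall v, exists2 p, X p & forall x, X x -> '[x, v - p] = 0.
Proof.
move=> X0 lX clX v.
have [||p Xp pP] := convex_projection _ _ clX v; first by exists 0.
  by move=> x y t Xx Xy _ _; rewrite addrC; apply: (lX) => //; rewrite -scaleN1r addrC; apply: (lX).
have rp x : X x -> rip x (v - p) = 0.
  move=> Xx; apply/eqP; rewrite eq_le.
  have := pP _ (lX 1 _ _ Xx Xp); have := pP _ (lX (-1) _ _ Xx Xp).
  by rewrite scaleN1r scale1r !addrK ripNl oppr_le0 => -> ->.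
have iX x : X x -> X ('i *: x) by move=> Xx; rewrite -[_ *: _]addr0; exact: lX.
exists p => // x Xx; rewrite innerE rp// -[rip x _]opprK -ripZi rp ?oppr0//; exact: iX.
Qed.

End Projection.

(** * Fixed points of contractions and coercive maps *)

Section FixedPoint.
Variable R : realType.

Lemma contraction_fixed (V : completeNormedModType R[i]) (F : V -> V) (q : R) :
  0 <= q -> q < 1 -> (forall x y, rnorm (F x - F y) <= q * rnorm (x - y)) ->
  exists x, F x = x.
Proof.
move=> q0 q1 Fq.
pose u n := iter n F 0; pose c := rnorm (u 1%N - u 0%N).
pose s n := c * (1 - q ^+ n) / (1 - q).
have q1' : 0 < 1 - q by rewrite subr_gt0.
have us n : rnorm (u n.+1 - u n) <= s n.+1 - s n.
  have -> : s n.+1 - s n = c * q ^+ n by rewrite /s exprS; field; rewrite gt_eqF.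
  elim: n => [|n IH]; first by rewrite expr0 mulr1 lexx.
  rewrite [u n.+2]iterS [u n.+1 in X in _ - X]iterS.
  by apply: le_trans (Fq _ _) _; rewrite exprS mulrCA ler_wpM2l.
have sM n : s n <= c / (1 - q).
  rewrite ler_pM2r ?invr_gt0// -{2}[c]mulr1 ler_wpM2l ?rnorm_ge0//.
  by rewrite gerBl exprn_ge0.
have [l [L [ul sL]]] := dominated_complete us sM.
exists l; apply/eqP; rewrite -subr_eq0; apply/eqP/rnorm_eq0/eqP.
rewrite eq_le rnorm_ge0 andbT; apply/ler_addgt0Pr => e e0.
have [|N /(_ N (leqnn _)) sN] := sL (e / 2); first by rewrite divr_gt0.
apply: le_trans (ler_rnormDist (u N.+1) _ _) _.
have F1 : rnorm (F l - u N.+1) <= L - s N.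
  rewrite [u N.+1]iterS; apply: le_trans (Fq _ _) _.
  apply: le_trans (ul N); apply: ler_piMl (ltW q1); exact: rnorm_ge0.
have F2 := ul N.+1; rewrite rnormB in F2.
by have := us N; have := rnorm_ge0 (u N.+1 - u N); lra.
Qed.

(** A Lax-Milgram argument: for [h - t (E h - y)] coercivity gains [2 t d] and boundedness costs
    [t^2 K^2], so [t = d / K^2] gives the squared contraction factor [p = 1 - d^2 / K^2]. Taking
    [K = |L| + d] ensures [d <= K], hence [p >= 0]. *)
Lemma coercive_surjective (V : hilbertType R) (E : V -> V) (L d : R) :
  (forall x y, E (x - y) = E x - E y) ->
  (forall x, rnorm (E x) <= L * rnorm x) -> 0 < d ->
  (forall x, d * rnorm x ^+ 2 <= rip (E x) x) -> forall y, exists x, E x = y.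
Proof.
move=> EB EL d0 Ed y.
pose K := `|L| + d; have K0 : 0 < K by rewrite ltr_wpDl.
have dK : d <= K by rewrite lerDr.
have EK x : rnorm (E x) ^+ 2 <= K ^+ 2 * rnorm x ^+ 2.
  rewrite -exprMn ler_pXn2r ?nnegrE ?mulr_ge0 ?rnorm_ge0 ?(ltW K0)//.
  apply: le_trans (EL x) _; rewrite ler_wpM2r ?rnorm_ge0//.
  by have := ler_norm L; rewrite /K; lra.
pose t := d / K ^+ 2; pose p := 1 - d ^+ 2 / K ^+ 2.
have t0 : 0 < t by rewrite divr_gt0// exprn_gt0.
have p0 : 0 <= p.
  by rewrite subr_ge0 ler_pdivrMr ?exprn_gt0// mul1r ler_pXn2r// nnegrE ltW.
have p1 : p < 1 by rewrite gtrBl divr_gt0// exprn_gt0.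
have [|||x xP] := @contraction_fixed V (fun h => h - t%:C *: (E h - y)) (Num.sqrt p).
- exact: sqrtr_ge0.
- by rewrite -sqrtr1 ltr_sqrt.
- move=> h k; have -> : h - t%:C *: (E h - y) - (k - t%:C *: (E k - y)) =
      (h - k) - t%:C *: E (h - k).
    by apply: rip_ext => z; rewrite EB !ripE; ring.
  move: (h - k) => x.
  rewrite -(ler_pXn2r (ltn0Sn 1)) ?nnegrE ?mulr_ge0 ?sqrtr_ge0 ?rnorm_ge0//.
  rewrite exprMn sqr_sqrtr// rnormB_sqr rnormZr ripZr exprMn real_normK ?num_real// ripC.
  have : t ^+ 2 * rnorm (E x) ^+ 2 <= t ^+ 2 * (K ^+ 2 * rnorm x ^+ 2).
    by rewrite ler_wpM2l ?EK// sqr_ge0.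
  have -> : t ^+ 2 * (K ^+ 2 * rnorm x ^+ 2) = d ^+ 2 / K ^+ 2 * rnorm x ^+ 2.
    by rewrite /t; field; rewrite gt_eqF.
  have : t * (d * rnorm x ^+ 2) <= t * rip (E x) x by rewrite ler_wpM2l ?Ed// ltW.
  have -> : t * (d * rnorm x ^+ 2) = d ^+ 2 / K ^+ 2 * rnorm x ^+ 2.
    by rewrite /t; field; rewrite gt_eqF.
  by rewrite /p; lra.
- exists x; apply: rip_ext => z; apply/eqP; rewrite -subr_eq0 -ripBl.
  have : rip (x - t%:C *: (E x - y)) z = rip x z by congr rip; exact: xP.
  rewrite (ripBl x) ripZl => /eqP.
  by rewrite subr_eq addrC -subr_eq subrr eq_sym mulf_eq0 (gt_eqF t0).
Qed.

End FixedPoint.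

(** * Limits in inner products, symmetric maps and positive square roots *)

Section SquareRoot.
Variable R : realType.

Lemma rip_limit (U V : hilbertType R) (x a : U) (y b : V) :
  (forall e : R, 0 < e -> exists x' y', [/\ rnorm (x - x') < e, rnorm (y - y') < e
     & rip x' a = rip y' b]) ->
  rip x a = rip y b.
Proof.
move=> H; apply/eqP; rewrite -subr_eq0 -normr_eq0 eq_le normr_ge0 andbT.
apply/ler_addgt0Pr => e e0; rewrite add0r.
pose k := rnorm a + rnorm b + 1.
have k0 : 0 < k by have := rnorm_ge0 a; have := rnorm_ge0 b; rewrite /k; lra.
have [x' [y' [xx yy xyE]]] := H _ (divr_gt0 e0 k0).
have -> : rip x a - rip y b = rip (x - x') a - rip (y - y') b.
  by rewrite !ripBl xyE; ring.
apply: le_trans (ler_normB _ _) _.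
apply: le_trans (lerD (rip_norm_le _ _) (rip_norm_le _ _)) _.
have : rnorm (x - x') * rnorm a <= e / k * rnorm a.
  by rewrite ler_wpM2r ?rnorm_ge0// ltW.
have : rnorm (y - y') * rnorm b <= e / k * rnorm b.
  by rewrite ler_wpM2r ?rnorm_ge0// ltW.
have : e / k * k = e by rewrite divfK ?gt_eqF.
have : 0 < e / k by rewrite divr_gt0.
by rewrite /k; nra.
Qed.

Lemma inner_limit_left (U V : hilbertType R) (x a : U) (y b : V) :
  (forall e : R, 0 < e -> exists x' y', [/\ rnorm (x - x') < e, rnorm (y - y') < e
     & '[x', a] = '[y', b]]) ->
  '[x, a] = '[y, b].
Proof.
move=> H; apply: inner_eqP; apply: rip_limit => e /H[x' [y' [xx yy E]]];
  exists x', y'; split=> //; first by rewrite /rip E.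
by rewrite -!Im_inner E.
Qed.

Lemma inner_limit (U V : hilbertType R) (x y0 : U) (x0 y : V) :
  (forall e : R, 0 < e -> exists x' y', [/\ rnorm (x - x') < e, rnorm (y - y') < e
     & '[x', y0] = '[x0, y']]) ->
  '[x, y0] = '[x0, y].
Proof.
have flip z : rip x0 ('i *: z) = rip z (- ('i *: x0)).
  by rewrite ripNr ripC ripZi.
move=> H; apply: inner_eqP; [rewrite [RHS]ripC | rewrite flip];
  apply: rip_limit => e /H[x' [y' [xx yy E]]];
  exists x', y'; split=> //; first by rewrite [RHS]ripC /rip E.
by rewrite -flip -!Im_inner E.
Qed.

(** Symmetry moves [F] to the other argument, where only the inner product has to be linear.
    Everywhere defined symmetric maps, such as the closure of [M(l)] and its root, thus get
    linearity for free. *)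
Lemma symmetric_linear (V : hilbertType R) (F : V -> V) :
  (forall x y, '[F x, y] = '[x, F y]) ->
  forall a x y, F (a *: x + y) = a *: F x + F y.
Proof.
move=> sF a x y; apply: rip_ext => z; rewrite /rip.
by rewrite sF innerDl innerZl -!sF -innerZl -innerDl.
Qed.

Lemma symmetric_sub (V : hilbertType R) (F : V -> V) :
  (forall x y, '[F x, y] = '[x, F y]) -> forall x y, F (x - y) = F x - F y.
Proof.
by move=> sF x y; rewrite addrC -scaleN1r symmetric_linear// scaleN1r addrC.
Qed.

Lemma symmetric_add (V : hilbertType R) (F : V -> V) :
  (forall x y, '[F x, y] = '[x, F y]) -> forall x y, F (x + y) = F x + F y.
Proof. by move=> sF x y; rewrite -[x in LHS]scale1r symmetric_linear// scale1r. Qed.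

Lemma symmetric_scale (V : hilbertType R) (F : V -> V) :
  (forall x y, '[F x, y] = '[x, F y]) -> forall a x, F (a *: x) = a *: F x.
Proof.
move=> sF a x; have F0 : F 0 = 0 by rewrite -[X in F X](subrr 0) symmetric_sub// subrr.
by rewrite -[_ *: _ in LHS]addr0 symmetric_linear// F0 addr0.
Qed.

Lemma symmetric_rip (V : hilbertType R) (F : V -> V) :
  (forall x y, '[F x, y] = '[x, F y]) -> forall x y, rip (F x) y = rip x (F y).
Proof. by move=> sF x y; rewrite /rip sF. Qed.

Section Positive.
Variables (V : hilbertType R) (A : V -> V).
Hypothesis A_sym : forall x y, '[A x, y] = '[x, A y].
Hypothesis A_ge0 : forall x, 0 <= rip (A x) x.

(** Cauchy-Schwarz for the semidefinite form [(A x, y)], at [x] and [A x], gives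
    [|A x|^4 <= (A x, x) (A A x, A x)]. *)
Lemma positive_le (k : R) : (forall x, rip (A x) x <= k * rnorm x ^+ 2) ->
  forall x, rnorm (A x) ^+ 2 <= k * rip (A x) x.
Proof.
move=> Ak x.
have : rip (A x) (A x) ^+ 2 <= rip (A x) x * rip (A (A x)) (A x).
  apply: sqr_le_of_quadratic => [|t]; first exact: A_ge0.
  have := A_ge0 (t%:C *: A x + x); rewrite symmetric_linear// !ripE.
  by rewrite (symmetric_rip A_sym (A x) x); lra.
rewrite ripxx => H; have Ax := Ak (A x).
have [->|Ax0] := eqVneq (rnorm (A x)) 0.
  rewrite expr0n/=; have := Ak x; have := A_ge0 x => x0 xk.
  have [k0|k0] := leP 0 k; first exact: mulr_ge0.
  suff -> : rip (A x) x = 0 by rewrite mulr0.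
  by have := sqr_ge0 (rnorm x); nra.
have Ax2 : 0 < rnorm (A x) ^+ 2 by rewrite exprn_gt0// lt_neqAle eq_sym Ax0 rnorm_ge0.
rewrite -(ler_pM2r Ax2) -expr2; apply: le_trans H _.
rewrite mulrAC [leRHS]mulrC; exact: ler_wpM2l.
Qed.

End Positive.

Section Root.
Variables (V : hilbertType R) (D : V -> V).
Hypothesis D_sym : forall x y, '[D x, y] = '[x, D y].
Hypothesis D_le : forall x, rnorm (D x) <= rnorm x.

(** The classical iteration [Y_(n+1) = (D + Y_n^2) / 2], whose fixed points [Z] satisfy
    [(1 - Z)^2 = 1 - D]. *)
Let fix_iter := fix Y (n : nat) (x : V) {struct n} : V :=
  if n is m.+1 then (2^-1)%:C *: (D x + Y m (Y m x)) else 0.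
Local Notation Y := fix_iter.

(** The same iteration with the scalar [1] in place of [D]. It dominates the norms of the [Y n], and
    its increments dominate theirs. *)
Let r := fix r (n : nat) : R := if n is m.+1 then (1 + r m ^+ 2) / 2 else 0.

Let r_itv n : 0 <= r n <= 1.
Proof. by elim: n => [|n /andP[r0 r1]] /=; [rewrite lexx ler01 | nra]. Qed.

Let Y_sym n : forall x y, '[Y n x, y] = '[x, Y n y].
Proof.
elim: n => [|n IH] x y /=; first by apply: inner_eqP; rewrite ?scaler0 !(rip0l, rip0r).
by rewrite innerZl innerZr conjc_real innerDl innerDr D_sym !IH.
Qed.

Let Y_le n x : rnorm (Y n x) <= r n * rnorm x.
Proof.
elim: n x => [|n IH] x /=; first by rewrite rnorm0 mul0r.
have /andP[r0 r1] := r_itv n.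
rewrite rnormZr ger0_norm ?invr_ge0// mulrC ler_pdivrMr//.
apply: le_trans (ler_rnormD _ _) _.
have := IH (Y n x); have := IH x; have := D_le x; have := rnorm_ge0 x.
by nra.
Qed.

(* Two consecutive iterates differ by
   [2^-1 (Y_(n+1) (Y_(n+1) - Y_n) + (Y_(n+1) - Y_n) Y_n)]. *)
Let Y_incr n x : rnorm (Y n.+1 x - Y n x) <= r n.+1 * rnorm x - r n * rnorm x.
Proof.
elim: n x => [|n IH] x.
  rewrite /= subr0 addr0 mul0r subr0 rnormZr ger0_norm ?invr_ge0//.
  by have := D_le x; rewrite expr0n/=; lra.
have -> : Y n.+2 x - Y n.+1 x =
    (2^-1)%:C *: (Y n.+1 (Y n.+1 x - Y n x) + (Y n.+1 (Y n x) - Y n (Y n x))).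
  rewrite (symmetric_sub (Y_sym n.+1)) addrA subrK.
  rewrite [Y n.+2]/= -/(Y n.+1) [in X in _ - X]/= -scalerBr; congr (_ *: _).
  by rewrite opprD addrACA subrr add0r.
rewrite rnormZr ger0_norm ?invr_ge0// mulrC ler_pdivrMr//.
apply: le_trans (ler_rnormD _ _) _.
have /andP[r0 r1] := r_itv n; have /andP[r0' r1'] := r_itv n.+1.
have H1 := Y_le n.+1 (Y n.+1 x - Y n x); have H2 := IH (Y n x); have H3 := IH x.
have H4 := Y_le n x.
have -> : r n.+2 = (1 + r n.+1 ^+ 2) / 2 by [].
have E : r n.+1 = (1 + r n ^+ 2) / 2 by [].
have rr : 0 <= r n.+1 - r n by rewrite E; have := sqr_ge0 (1 - r n); lra.
have H5 : r n.+1 * rnorm (Y n.+1 x - Y n x) <= r n.+1 * (r n.+1 * rnorm x - r n * rnorm x).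
  exact: ler_wpM2l.
have H6 : (r n.+1 - r n) * rnorm (Y n x) <= (r n.+1 - r n) * (r n * rnorm x).
  exact: ler_wpM2l.
have E' : r n.+1 * 2 = 1 + r n ^+ 2 by rewrite E divfK.
have : rnorm x * (r n.+1 * 2) = rnorm x * (1 + r n ^+ 2) by rewrite E'.
by lra.
Qed.

(** The iterates converge pointwise to a symmetric contraction [Z] with [2 Z = D + Z^2]. Then
    [Q = 1 - Z] squares to [1 - D], and [|Z x| <= |x|] makes it non-negative. *)
Lemma sqrt_one_sub : exists Q : V -> V, [/\ forall x y, '[Q x, y] = '[x, Q y],
  forall x, 0 <= rip (Q x) x & forall x, Q (Q x) = x - D x].
Proof.
have /choice[Z ZP] : forall x, exists l, forall e : R, 0 < e ->
    exists N, forall n, (N <= n)%N -> rnorm (l - Y n x) < e.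
  move=> x; have [||l [L [Yl Ls]]] :=
    @dominated_complete R V (Y ^~ x) (fun n => r n * rnorm x) (rnorm x).
  - by move=> n; exact: Y_incr.
  - by move=> n; apply: ler_piMl; rewrite ?rnorm_ge0//; case/andP: (r_itv n).
  exists l => e /Ls[N LN]; exists N => n /LN; exact: le_lt_trans.
have Y1 n x : rnorm (Y n x) <= rnorm x.
  apply: le_trans (Y_le n x) _; apply: ler_piMl; first exact: rnorm_ge0.
  by case/andP: (r_itv n).
have Z_sym x y : '[Z x, y] = '[x, Z y].
  apply: inner_limit => e e0; have [N1 ZN1] := ZP x _ e0; have [N2 ZN2] := ZP y _ e0.
  exists (Y (maxn N1 N2) x), (Y (maxn N1 N2) y).
  by split; [apply: ZN1; exact: leq_maxl | apply: ZN2; exact: leq_maxr | exact: Y_sym].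
have Z1 x : rnorm (Z x) <= rnorm x.
  apply/ler_addgt0Pr => e /ZP -/(_ x)[N /(_ N (leqnn _)) ZN].
  have := ler_rnormD (Z x - Y N x) (Y N x); rewrite subrK.
  by have := Y1 N x; lra.
have ZZ x : Z x = (2^-1)%:C *: (D x + Z (Z x)).
  apply/eqP; rewrite -subr_eq0; apply/eqP/rnorm_eq0/eqP.
  rewrite eq_le rnorm_ge0 andbT; apply/ler_addgt0Pr => e e0; rewrite add0r.
  have e2 : 0 < e / 2 by rewrite divr_gt0.
  have [N1 ZN1] := ZP x _ e2; have [N2 ZN2] := ZP (Z x) _ e2.
  pose n := maxn N1 N2.
  have := ZN1 n.+1 (leqW (leq_maxl _ _)) => H0.
  have := ZN1 n (leq_maxl _ _) => H1; have := ZN2 n (leq_maxr _ _) => H2.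
  apply: le_trans (ler_rnormDist (Y n.+1 x) _ _) _.
  suff : rnorm (Y n.+1 x - (2^-1)%:C *: (D x + Z (Z x))) <= e / 2 by lra.
  rewrite /= -/(Y n) -scalerBr opprD addrACA subrr add0r rnormZr ger0_norm ?invr_ge0//.
  rewrite mulrC ler_pdivrMr//; apply: le_trans (ler_rnormDist (Y n (Z x)) _ _) _.
  rewrite -(symmetric_sub (Y_sym n)); have := Y1 n (Y n x - Z x).
  by rewrite [rnorm (Y n x - Z x)]rnormB [rnorm (_ - Z (Z x))]rnormB; move: H1 H2; lra.
exists (fun x => x - Z x); split=> [x y|x|x].
- by rewrite innerBl innerBr Z_sym.
- have := rip_le (Z x) x; have := Z1 x; have := rnorm_ge0 x.
  by rewrite ripBl ripxx; nra.
- rewrite (symmetric_sub Z_sym); apply: rip_ext => z.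
  by have := congr1 (fun v => rip v z) (ZZ x); rewrite !ripE; lra.
Qed.

End Root.

(** Rescaling reduces to [D = 1 - A / k], which lies between [0] and [1] and is a contraction by
    [positive_le]; the root of [1 - D = A / k] is multiplied by [sqrt k]. *)
Lemma positive_sqrt (V : hilbertType R) (A : V -> V) (k : R) :
  (forall x y, '[A x, y] = '[x, A y]) -> (forall x, 0 <= rip (A x) x) ->
  0 < k -> (forall x, rip (A x) x <= k * rnorm x ^+ 2) ->
  exists Q : V -> V, [/\ forall x y, '[Q x, y] = '[x, Q y],
    forall x, 0 <= rip (Q x) x & forall x, Q (Q x) = A x].
Proof.
move=> A_sym A_ge0 k0 Ak.
pose D x := x - (k^-1)%:C *: A x.
have D_sym x y : '[D x, y] = '[x, D y].
  by rewrite /D innerBl innerBr innerZl innerZr conjc_real A_sym.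
have ik : 0 < k^-1 by rewrite invr_gt0.
have D_ge0 x : 0 <= rip (D x) x.
  by rewrite /D !ripE ripxx subr_ge0 mulrC ler_pdivrMr// mulrC.
have D_le x : rnorm (D x) <= rnorm x.
  have D1 y : rip (D y) y <= 1 * rnorm y ^+ 2.
    by rewrite /D !ripE ripxx mul1r gerBl mulr_ge0// ltW.
  rewrite -(ler_pXn2r (ltn0Sn 1)) ?nnegrE ?rnorm_ge0//.
  have := positive_le D_sym D_ge0 D1 x; rewrite mul1r => /le_trans; apply.
  by rewrite -[leRHS]mul1r.
have [Q [Q_sym Q_ge0 QQ]] := sqrt_one_sub D_sym D_le.
exists (fun x => (Num.sqrt k)%:C *: Q x); split=> [x y|x|x].
- by rewrite innerZl innerZr conjc_real Q_sym.
- by rewrite ripZl mulr_ge0// sqrtr_ge0.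
- rewrite (symmetric_scale Q_sym).
  rewrite scalerA -rmorphM/= -expr2 sqr_sqrtr ?(ltW k0)// QQ /D opprB addrC subrK.
  by rewrite scalerA -rmorphM/= divff ?gt_eqF// scale1r.
Qed.

End SquareRoot.

(** * The closed graph theorem *)

Section ClosedGraph.
Variables (R : realType) (V W : completeNormedModType R[i]) (F : V -> W).
Hypothesis FB : forall x y, F (x - y) = F x - F y.
Hypothesis FZ : forall (t : R) x, F (t%:C *: x) = t%:C *: F x.
Hypothesis F_closable : forall y, (forall e : R, 0 < e ->
  exists2 x, rnorm x < e & rnorm (y - F x) < e) -> y = 0.

(* The Baire category step. *)
Let somewhere_dense : exists (n : nat) x0 (r : R), 0 < r /\
  forall x, rnorm (x - x0) < r -> forall e : R, 0 < e ->
    exists2 x', rnorm (F x') <= n%:R & rnorm (x' - x) < e.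
Proof.
apply: contrapT => H.
have step (a : nat * (V * R)) : exists b : V * R, 0 < a.2.2 ->
    [/\ 0 < b.2, b.2 <= a.2.2 / 2, rnorm (b.1 - a.2.1) <= a.2.2 / 2
      & forall x, rnorm (x - b.1) <= b.2 -> a.1%:R < rnorm (F x)].
  case: a => n [x0 r] /=; have [r0|r0] := leP r 0.
    by exists (x0, r).
  have r2 : 0 < r / 2 by rewrite divr_gt0.
  have [x [e [e0 xr xe]]] : exists x e, [/\ 0 < e, rnorm (x - x0) < r / 2
      & forall x', rnorm (x' - x) < e -> n%:R < rnorm (F x')].
    apply: contrapT => H'; apply: H; exists n, x0, (r / 2); split => // x xr e e0.
    apply: contrapT => H; apply: H'; exists x, e; split => // x' xx'.
    by rewrite ltNge; apply/negP => Fx; apply: H; exists x'.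
  exists (x, Num.min (r / 2) (e / 2)) => _ /=; split.
  - by rewrite lt_min r2 divr_gt0.
  - by rewrite ge_min lexx.
  - exact: ltW.
  - by move=> y; rewrite le_min => /andP[_ ye]; apply: xe; apply: le_lt_trans ye _; lra.
have [g gP] := choice step.
pose a := fix a n : V * R := if n is m.+1 then g (m, a m) else (0, 1).
have a0 n : 0 < (a n).2.
  by elim: n => [|n IH] /=; [exact: ltr01 | have [] := gP (n, a n) IH].
have aP n := gP (n, a n) (a0 n).
(* The centres move by at most the loss of radius, so the negated radii dominate them, and the limit
   lies in every closed ball of the nest. *)
have [||l [L [la Ls]]] := @dominated_complete R V (fun n => (a n).1) (fun n => - (a n).2) 0.
- by move=> n; have [/= _ h1 h2 _] := aP n; move: h1 h2 => /=; lra.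
- by move=> n; rewrite oppr_le0 ltW.
have L0 : L <= 0.
  apply/ler_addgt0Pr => e /Ls[N /(_ N (leqnn _))]; have := a0 N; lra.
have Fl n : n%:R < rnorm (F l).
  have [_ _ _] := aP n; apply; apply: le_trans (la n.+1) _ => /=.
  by rewrite opprK gerDr.
have [n] := ltr_add_invr (ltr01 : 0 < 1 :> R).
by have := Fl (Num.bound (rnorm (F l))); have := archi_boundP (rnorm_ge0 (F l)); lra.
Qed.

(** Subtraction and scaling turn the ball of [somewhere_dense] into this: every [x] is approximated
    arbitrarily well by some [x'] with [|F x'| <= c |x|]. Iterated on the remainders [z k], whose
    norms are at most [|x| / 2^k], this makes [F (z k)] converge; closability forces the limit to be
    [0], and summing the geometric increments bounds [F x]. *)
Lemma closed_graph_bounded : exists c : R, forall x, rnorm (F x) <= c * rnorm x.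
Proof.
have F0 : F 0 = 0 by rewrite -(subrr 0) FB subrr.
have [n [x0 [r [r0 dn]]]] := somewhere_dense.
(* With [t = r / (2 |x|)] the point [x0 + t x] stays in the ball. The images of two approximants
   differ by at most [2 n], and division by [t] gives [c |x|]. *)
pose c := (n%:R + n%:R) * (2 / r).
have c0 : 0 <= c by rewrite mulr_ge0 ?addr_ge0 ?divr_ge0// ltW.
have ap (p : V * R) : exists x', 0 < p.2 -> rnorm (F x') <= c * rnorm p.1 /\ rnorm (x' - p.1) < p.2.
  case: p => x e /=; have [->|x1] := eqVneq x 0.
    by exists 0; rewrite F0 subrr !rnorm0 mulr0.
  have x2 := rnorm_gt0 x1.
  pose t := r / (2 * rnorm x); have t0 : 0 < t by rewrite divr_gt0// mulr_gt0.
  have [e0|e0] := leP e 0; first by exists 0.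
  have te : 0 < t * (e / 2) by rewrite mulr_gt0// divr_gt0.
  have [|y1 Fy1 y1x] := dn (x0 + t%:C *: x) _ _ te.
    rewrite addrC addKr rnormZr gtr0_norm// /t.
    have -> : r / (2 * rnorm x) * rnorm x = r / 2 by field; rewrite gt_eqF.
    by lra.
  have [|y0 Fy0 y0x] := dn x0 _ _ te; first by rewrite subrr rnorm0.
  exists (t^-1%:C *: (y1 - y0)) => _; split.
    rewrite FZ FB rnormZr gtr0_norm ?invr_gt0//.
    have -> : c * rnorm x = t^-1 * (n%:R + n%:R).
      by rewrite /c /t; field; rewrite !gt_eqF.
    rewrite ler_pM2l ?invr_gt0//; apply: le_trans (ler_rnormD _ _) _.
    by rewrite rnormN lerD.
  have -> : t^-1%:C *: (y1 - y0) - x = t^-1%:C *: ((y1 - (x0 + t%:C *: x)) - (y0 - x0)).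
    have -> : x = t^-1%:C *: (t%:C *: x).
      by rewrite scalerA -rmorphM/= mulVf ?gt_eqF// scale1r.
    rewrite -scalerBr; congr (_ *: _); rewrite scalerA -rmorphM/= mulfV ?gt_eqF// scale1r.
    have E : y0 + t%:C *: x = x0 + t%:C *: x + (y0 - x0).
      by rewrite [x0 + _]addrC [y0 - x0]addrC addrA addrK addrC.
    by rewrite -[LHS]addrA -opprD E opprD addrA.
  rewrite rnormZr gtr0_norm ?invr_gt0// mulrC ltr_pdivrMr//.
  apply: le_lt_trans (ler_rnormD _ _) _; rewrite rnormN.
  have -> : e * t = t * (e / 2) + t * (e / 2) by field.
  exact: ltrD.
have [h hP] := choice ap.
exists (2 * c) => x; have [->|x1] := eqVneq x 0; first by rewrite F0 !rnorm0 mulr0.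
pose d := rnorm x; have d0 : 0 < d by exact: rnorm_gt0.
pose z := fix z k := if k is m.+1 then z m - h (z m, d / 2 ^+ m.+1) else x.
have dk k : 0 < d / 2 ^+ k by rewrite divr_gt0// exprn_gt0.
have dk0 k : 0 <= 2 * c * (d / 2 ^+ k).
  by apply: mulr_ge0; [exact: mulr_ge0 | exact: ltW].
have zd k : rnorm (z k) <= d / 2 ^+ k.
  case: k => [|k] /=; first by rewrite expr0 divr1.
  by rewrite rnormB ltW//; have [] := hP (z k, d / 2 ^+ k.+1) (dk _).
have Fz k : rnorm (F (z k.+1) - F (z k)) <= c * (d / 2 ^+ k).
  rewrite /= FB addrAC subrr add0r rnormN.
  have [/= + _] := hP (z k, d / 2 ^+ k.+1) (dk _) => /le_trans; apply.
  by rewrite ler_wpM2l.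
have [||l [L [lF Ls]]] :=
  @dominated_complete R W (F \o z) (fun k => - (2 * c * (d / 2 ^+ k))) 0.
- move=> k; apply: le_trans (Fz k) _; rewrite exprS.
  have -> : d / (2 * 2 ^+ k) = d / 2 ^+ k / 2 by field; rewrite expf_neq0.
  by lra.
- by move=> k; rewrite oppr_le0.
have L0 : L <= 0.
  apply/ler_addgt0Pr => e /Ls[N /(_ N (leqnn _))].
  by have := dk0 N; clear; lra.
have l0 : l = 0.
  apply: F_closable => e e0.
  have [N LN] := Ls _ e0; have [M dM] := invS_small (divr_gt0 e0 d0).
  pose k := maxn N M; exists (z k); last first.
    by apply: le_lt_trans (lF k) _; apply: LN; exact: leq_maxl.
  apply: le_lt_trans (zd k) _; have := dM k (leq_maxr _ _); rewrite ltr_pdivlMr// mulrC.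
  apply: le_lt_trans; rewrite ler_pM2l// lef_pV2 ?posrE ?exprn_gt0//.
  by rewrite -natrX ler_nat ltn_expl.
have := lF 0%N; rewrite l0 sub0r rnormN /= expr0 divr1 opprK; rewrite -/d.
by move: L0; clear; lra.
Qed.

End ClosedGraph.

(** * Linear, closable and self-adjoint operators *)

Section LinearOn.
Variables (R : realType) (U V : lmodType R[i]) (D : set U) (f : U -> V).
Hypothesis lf : linear_on D f.

Lemma linear_on_dom0 : D 0. Proof. exact: lf.1. Qed.

Lemma linear_on_domP a x y : D x -> D y -> D (a *: x + y).
Proof. by move=> Dx Dy; exact: (lf.2 a x y Dx Dy).1. Qed.

Lemma linear_on_domZ a x : D x -> D (a *: x).
Proof. by move=> Dx; rewrite -[_ *: _]addr0; apply: linear_on_domP => //; exact: lf.1. Qed.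

Lemma linear_on_domD x y : D x -> D y -> D (x + y).
Proof. by rewrite -[x in D (x + _)]scale1r; exact: linear_on_domP. Qed.

Lemma linear_on_domB x y : D x -> D y -> D (x - y).
Proof. by move=> Dx Dy; rewrite addrC -scaleN1r; exact: linear_on_domP. Qed.

Lemma linear_onP a x y : D x -> D y -> f (a *: x + y) = a *: f x + f y.
Proof. by move=> Dx Dy; exact: (lf.2 a x y Dx Dy).2. Qed.

Lemma linear_onD x y : D x -> D y -> f (x + y) = f x + f y.
Proof. by move=> Dx Dy; rewrite -[x in LHS]scale1r linear_onP// scale1r. Qed.

Lemma linear_onB x y : D x -> D y -> f (x - y) = f x - f y.
Proof. by move=> Dx Dy; rewrite addrC -scaleN1r linear_onP// scaleN1r addrC. Qed.

Lemma linear_on0 : f 0 = 0.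
Proof. by rewrite -(subrr 0) linear_onB ?subrr//; exact: lf.1. Qed.

Lemma linear_onZ a x : D x -> f (a *: x) = a *: f x.
Proof.
by move=> Dx; rewrite -[_ *: _ in LHS]addr0 linear_onP ?linear_on0 ?addr0//; exact: lf.1.
Qed.

End LinearOn.

Section Closure.
Variables (R : realType) (U V : normedModType R[i]) (A : op U V).
Hypothesis A_lin : linear_op A.

Lemma closure_graph_linear a x y x' y' : closure (graph A) (x, y) ->
  closure (graph A) (x', y') -> closure (graph A) (a *: x + x', a *: y + y').
Proof.
move=> /closure_graphP H /closure_graphP H'; apply/closure_graphP => e e0.
pose k := rnorm (a : R[i]^o) + 1.
have k0 : 0 < k by rewrite ltr_wpDl ?rnorm_ge0.
have e2 : 0 < e / 2 by rewrite divr_gt0.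
have [u [Au xu yu]] := H _ (divr_gt0 e2 k0); have [u' [Au' xu' yu']] := H' _ e2.
have est (W : normedModType R[i]) (w v w' v' : W) : rnorm (w - v) < e / 2 / k ->
    rnorm (w' - v') < e / 2 -> rnorm (a *: w + w' - (a *: v + v')) < e.
  move=> wv wv'; rewrite opprD addrACA -scalerBr.
  apply: le_lt_trans (ler_rnormD _ _) _; rewrite rnormZ.
  have : rnorm (a : R[i]^o) * rnorm (w - v) <= k * (e / 2 / k).
    by rewrite ler_pM ?rnorm_ge0//; [by rewrite /k lerDl | exact: ltW].
  by rewrite mulrCA divff ?gt_eqF// mulr1; lra.
exists (a *: u + u'); rewrite (linear_onP A_lin)//.
by split; [exact: (linear_on_domP A_lin) | exact: est | exact: est].
Qed.

Hypothesis A_closable : closable A.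

Lemma closure_op_eq x y : closure (graph A) (x, y) -> closure_op A x = y.
Proof.
move=> xy; apply: xget_subset1 => // z w xz xw.
apply/eqP; rewrite -subr_eq0; apply/eqP/A_closable.
have := closure_graph_linear (a := -1) xw xz.
by rewrite !scaleN1r addNr [- w + z]addrC.
Qed.

Lemma closure_op_ext x : dom A x -> closure (graph A) (x, A x).
Proof. by move=> Ax; apply/subset_closure. Qed.

Lemma opnorm_bound (K : R) : (opnorm (closure_op A) <= K%:E)%E ->
  forall x, dom A x -> rnorm (A x) <= K * rnorm x.
Proof.
move=> AK x Ax; have [->|x0] := eqVneq x 0.
  by rewrite (linear_on0 A_lin) !rnorm0 mulr0.
have x1 := rnorm_gt0 x0; pose y := (rnorm x)^-1%:C *: x.
have Ay : dom A y by exact: (linear_on_domZ A_lin).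
have : ((rnorm (A y))%:E <= K%:E)%E.
  apply: le_trans AK; apply: ereal_sup_ubound; exists y.
    split; first by exists (A y); exact: closure_op_ext.
    by rewrite /mkset /y rnormZr gtr0_norm ?invr_gt0// mulVf ?gt_eqF.
  by rewrite (closure_op_eq (closure_op_ext Ay)).
rewrite lee_fin (linear_onZ A_lin)// rnormZr gtr0_norm ?invr_gt0//.
by rewrite mulrC ler_pdivrMr.
Qed.

Lemma closure_op_bound (K : R) : (forall x, dom A x -> rnorm (A x) <= K * rnorm x) ->
  forall x y, closure (graph A) (x, y) -> rnorm y <= K * rnorm x.
Proof.
move=> AK x y /closure_graphP H; apply/ler_addgt0Pr => e e0.
pose k := `|K| + 1; have k0 : 0 < k by rewrite ltr_wpDl.
have [u [Au xu yu]] := H _ (divr_gt0 (divr_gt0 e0 (ltr0n _ 2)) k0).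
have yy : rnorm y <= rnorm (y - A u) + rnorm (A u).
  by rewrite -{1}(subrK (A u) y); exact: ler_rnormD.
apply: le_trans yy _; have := AK _ Au.
have e2 : e / 2 / k <= e / 2 by rewrite ler_pdivrMr// ler_peMr ?divr_ge0 ?(ltW e0)// /k lerDr.
have xx : rnorm x <= rnorm (x - u) + rnorm u.
  by rewrite -{1}(subrK u x); exact: ler_rnormD.
have xx' : rnorm u <= rnorm (x - u) + rnorm x.
  by rewrite rnormB -{1}(subrK x u); exact: ler_rnormD.
have : `|K| * (rnorm (x - u)) <= k * (e / 2 / k).
  by rewrite ler_pM ?rnorm_ge0//; [by rewrite /k lerDl | exact: ltW].
rewrite [k * _]mulrCA divff ?gt_eqF// mulr1 => h1.
have : K * (rnorm u - rnorm x) <= `|K| * rnorm (x - u).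
  apply: le_trans (ler_norm _) _; rewrite normrM ler_wpM2l//.
  by rewrite ler_norml; apply/andP; split; lra.
by move: h1 e2 yu; lra.
Qed.

End Closure.

Lemma bounded_closable (R : realType) (U V : normedModType R[i]) (A : op U V) :
  linear_op A -> bounded_op A -> closable A.
Proof.
move=> lA [c Ac] y /(closure_op_bound Ac); rewrite rnorm0 mulr0 => y0.
by apply: rnorm_eq0; apply/eqP; rewrite eq_le y0 rnorm_ge0.
Qed.

(** [fine] would turn an infinite norm into [0]. Boundedness excludes this, so the real number is a
    genuine bound. *)
Lemma fine_opnorm_bound (R : realType) (U V : normedModType R[i]) (A : op U V) :
  linear_op A -> bounded_op A -> 0 <= fine (opnorm (closure_op A)) /\
  forall x, dom A x -> rnorm (A x) <= fine (opnorm (closure_op A)) * rnorm x.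
Proof.
move=> lA bA; have cA := bounded_closable lA bA; case: (bA) => c Ac.
have o0 : (0 <= opnorm (closure_op A))%E.
  have A0 := linear_on_dom0 lA.
  apply: ereal_sup_ubound; exists 0.
    split; first by exists (A 0); exact: closure_op_ext.
    by rewrite /= rnorm0.
  by rewrite (closure_op_eq lA cA (closure_op_ext A0)) (linear_on0 lA) rnorm0.
have oc : (opnorm (closure_op A) <= `|c|%:E)%E.
  apply: ub_ereal_sup => _ [x [[y xy] x1] <-]; rewrite lee_fin.
  rewrite (closure_op_eq lA cA xy); apply: le_trans (closure_op_bound Ac xy) _.
  apply: le_trans (ler_norm _) _; rewrite normrM (ger0_norm (rnorm_ge0 x)).
  exact: ler_piMr.
have fo : opnorm (closure_op A) \is a fin_num.
  by rewrite ge0_fin_numE//; apply: le_lt_trans oc (ltry _).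
by split; [exact: fine_ge0 | apply: opnorm_bound => //; rewrite fineK].
Qed.

Section Adjoint.
Variables (R : realType) (H G : hilbertType R) (A : op H G).

Lemma adjoint_inner x y : dom A x -> dom (adjoint A) y ->
  '[A x, y] = '[x, adjoint A y].
Proof. by move=> Ax yP; exact: (xgetPex 0 yP). Qed.

Lemma adjoint_eq y z : densely_defined A ->
  (forall x, dom A x -> '[A x, y] = '[x, z]) ->
  dom (adjoint A) y /\ adjoint A y = z.
Proof.
move=> dA yz; have Ay : dom (adjoint A) y by exists z.
split=> //; apply/eqP; rewrite -subr_eq0; apply/eqP.
apply: (dense_rip0 dA) => x Ax; rewrite ripC ripBr /rip -adjoint_inner// yz//.
by rewrite subrr.
Qed.

End Adjoint.

Section SelfAdjoint.
Variables (R : realType) (H : hilbertType R) (A : op H H).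
Hypothesis A_sa : self_adjoint A.

Lemma self_adjoint_sym x y : dom A x -> dom A y -> '[A x, y] = '[x, A y].
Proof.
move=> Ax Ay; have : graph A (y, A y) by [].
by rewrite A_sa.2 => -[/= y1 ->]; exact: adjoint_inner.
Qed.

(** The form in which self-adjointness produces elements of [dom A]: a weak solution is a strong
    one. *)
Lemma self_adjoint_max y z : (forall x, dom A x -> '[A x, y] = '[x, z]) ->
  dom A y /\ A y = z.
Proof.
move=> yz; have [Ay yE] := adjoint_eq A_sa.1 yz.
have : graph (adjoint A) (y, z) by [].
by rewrite -A_sa.2 => -[].
Qed.

Lemma self_adjoint_linear : linear_op A.
Proof.
split=> [|a x y Ax Ay].
  by apply: (@self_adjoint_max 0 0 _).1 => x _; apply: inner_eqP; rewrite ?scaler0 !rip0r.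
apply: self_adjoint_max => z Az.
by rewrite !innerDr !innerZr !self_adjoint_sym.
Qed.

(** [A - l] is bounded below by [c - l > 0], so its range is closed. A vector orthogonal to the
    range lies in [dom A] with [A w = l w], which the lower bound [c > l] allows only for
    [w = 0]. *)
Lemma self_adjoint_surjective (c l : R) :
  (forall x, dom A x -> c * rnorm x ^+ 2 <= rip (A x) x) -> l < c ->
  forall g, exists2 f, dom A f & A f - l%:C *: f = g.
Proof.
move=> Ac lc g; have lA := self_adjoint_linear.
have below x : dom A x -> (c - l) * rnorm x <= rnorm (A x - l%:C *: x).
  move=> Ax; have := rip_le (A x - l%:C *: x) x.
  rewrite ripBl ripZl ripxx; have := Ac x Ax.
  have := rnorm_ge0 x; rewrite le_eqVlt => /predU1P[<-|x0].
    by move=> _ _; rewrite mulr0 rnorm_ge0.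
  by move=> h1 h2; rewrite -(ler_pM2r x0); lra.
pose E : set H := [set A x - l%:C *: x | x in dom A].
have [|a _ _ [x Ax <-] [y Ay <-]|p pE|p [f Af <-] orth] := @subspace_projection R H E _ _ _ g.
- exists 0; first exact: linear_on_dom0 lA.
  by rewrite (linear_on0 lA) scaler0 subr0.
- exists (a *: x + y); first exact: (linear_on_domP lA).
  rewrite (linear_onP lA)// scalerDr scalerBr opprD addrACA; congr (_ + _ + _).
  by rewrite !scalerA mulrC.
- have cl0 : 0 < c - l by rewrite subr_gt0.
  have /choice[u uP] (n : nat) : exists x, dom A x /\ rnorm (p - (A x - l%:C *: x)) < n.+1%:R^-1.
    by have [|_ [x Ax <-] xn] := pE n.+1%:R^-1; [rewrite invr_gt0|exists x].
  have uB m n : (c - l) * rnorm (u m - u n) <= m.+1%:R^-1 + n.+1%:R^-1.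
    have [[Am um] [An un]] := (uP m, uP n).
    apply: le_trans (below _ (linear_on_domB lA Am An)) _.
    rewrite (linear_onB lA)//.
    have -> : A (u m) - A (u n) - l%:C *: (u m - u n) =
        (A (u m) - l%:C *: u m - p) + (p - (A (u n) - l%:C *: u n)).
      by apply: rip_ext => z; rewrite !ripE; ring.
    by apply: le_trans (ler_rnormD _ _) _; rewrite rnormB lerD// ltW.
  have [f uf] : exists l, forall e : R, 0 < e -> exists N, forall n, (N <= n)%N ->
      rnorm (u n - l) < e.
    apply: rnorm_complete => e e0.
    have [|N sN] := @invS_small R (e * (c - l) / 2); first by rewrite divr_gt0// mulr_gt0.
    exists N => m n Nm Nn; rewrite -(ltr_pM2l cl0).
    apply: le_lt_trans (uB m n) _; apply: lt_le_trans (ltrD (sN _ Nm) (sN _ Nn)) _; lra.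
  have [|Af AfE] := @self_adjoint_max f (p + l%:C *: f); last first.
    by exists f; rewrite // AfE addrK.
  move=> x Ax; rewrite innerC [RHS]innerC; congr (conjc _); apply/esym.
  apply: inner_limit_left => e e0.
  pose k := `|l| + 1; have k0 : 0 < k by rewrite ltr_wpDl.
  have e2 : 0 < e / 2 by rewrite divr_gt0.
  have [N1 H1] := uf _ (divr_gt0 e2 k0); have [N2 H2] := invS_small e2.
  pose n := maxn N1 N2; have h1 := H1 n (leq_maxl _ _); have h2 := H2 n (leq_maxr _ _).
  have [An un] := uP n.
  have ek : e / 2 / k <= e / 2 by rewrite ler_pdivrMr// ler_peMr ?(ltW e2)// /k lerDr.
  exists (A (u n)), (u n); split; last by rewrite self_adjoint_sym.
    have -> : p + l%:C *: f - A (u n) = (p - (A (u n) - l%:C *: u n)) - l%:C *: (u n - f).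
      by apply: rip_ext => z; rewrite !ripE; ring.
    apply: le_lt_trans (ler_rnormD _ _) _; rewrite rnormN rnormZr.
    have : `|l| * rnorm (u n - f) <= k * (e / 2 / k).
      by rewrite ler_pM ?rnorm_ge0//; [by rewrite /k lerDl | exact: ltW].
    rewrite mulrCA divff ?gt_eqF// mulr1 => h3.
    by move: h2 h3; have := un; set z := n.+1%:R^-1; lra.
  by rewrite rnormB; apply: lt_le_trans h1 _; lra.
have [|Ag gE] := @self_adjoint_max (g - (A f - l%:C *: f)) (l%:C *: (g - (A f - l%:C *: f))).
  move=> x Ax; have := orth _ (ex_intro2 _ _ x Ax erefl).
  rewrite innerBl innerZl innerZr conjc_real => /eqP.
  by rewrite subr_eq0 => /eqP.
exists f => //; apply/eqP; rewrite eq_sym -subr_eq0; apply/eqP.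
move: Ag gE; set w := g - _ => Aw wE.
have := Ac w Aw; rewrite wE ripZl ripxx -subr_ge0 -mulrBl => h.
have : 0 <= rnorm w ^+ 2 by exact: sqr_ge0.
apply: contraTeq => /rnorm_gt0 w0; rewrite -ltNge.
by have := exprn_gt0 2 w0; nra.
Qed.

(** Let [m] be the best lower bound not exceeding [mu]. If [m < mu], then [m] lies in the resolvent
    set, and the bounded inverse of [A - m] yields a better lower bound. *)
Lemma self_adjoint_lower_bound (c0 mu : R) :
  (forall x, dom A x -> c0 * rnorm x ^+ 2 <= rip (A x) x) ->
  (forall l : R, l < mu -> resolvent_set A l%:C) ->
  forall x, dom A x -> mu * rnorm x ^+ 2 <= rip (A x) x.
Proof.
move=> Ac0 Amu; have lA := self_adjoint_linear.
pose E : set R := [set c | c <= mu /\ forall x, dom A x -> c * rnorm x ^+ 2 <= rip (A x) x].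
have hE : has_sup E.
  split; last by exists mu => c [].
  exists (Num.min c0 mu); split=> [|x Ax]; first by rewrite ge_min lexx orbT.
  by apply: le_trans (Ac0 x Ax); rewrite ler_wpM2r ?sqr_ge0// ge_min lexx.
pose m := sup E.
have Am x : dom A x -> m * rnorm x ^+ 2 <= rip (A x) x.
  move=> Ax; have [->|x0] := eqVneq x 0.
    by rewrite rnorm0 expr0n/= mulr0 rip0r.
  have x1 : 0 < rnorm x ^+ 2 by rewrite exprn_gt0// rnorm_gt0.
  rewrite -ler_pdivlMr//; apply: ge_sup; first exact: hE.1.
  by move=> c [_ Ac]; rewrite ler_pdivlMr// Ac.
have mmu : m <= mu by apply: ge_sup; [exact: hE.1 | move=> c []].
have [->//|mne] := eqVneq mu m => x Ax.
have ltm : m < mu by rewrite lt_neqAle eq_sym mne.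
have [[_ _ Asurj] [c Abd]] := Amu _ ltm.
(* The form [A - m] is non-negative, so Cauchy-Schwarz with the preimage
   [g] of [f] under [A - m] bounds it from below by [|f|^2 / c]. *)
pose k := `|c| + 1; have k0 : 0 < k by rewrite ltr_wpDl.
have better f : dom A f -> (m + k^-1) * rnorm f ^+ 2 <= rip (A f) f.
  move=> Af; have [g Ag gE] := Asurj f I.
  pose s (u v : H) := rip (A u) v - m * rip u v.
  have sff u : dom A u -> 0 <= s u u by move=> Au; rewrite subr_ge0 ripxx Am.
  have : s f g ^+ 2 <= s f f * s g g.
    apply: sqr_le_of_quadratic => [|t]; first exact: sff.
    have := sff _ (linear_on_domP lA t%:C Ag Af).
    rewrite /s (linear_onP lA)// !ripE.
    have -> : rip (A g) f = rip (A f) g by rewrite [RHS]ripC /rip self_adjoint_sym.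
    by rewrite (ripC g f); lra.
  have -> : s f g = rnorm f ^+ 2.
    have AfgE : rip (A f) g = rip f (A g) by rewrite /rip self_adjoint_sym.
    by rewrite /s AfgE -(ripZr m f g) -ripBr gE ripxx.
  have sgg : s g g <= k * rnorm f ^+ 2.
    have -> : s g g = rip f g by rewrite /s -(ripZl m g g) -ripBl gE.
    apply: le_trans (rip_le _ _) _.
    have -> : k * rnorm f ^+ 2 = rnorm f * (k * rnorm f) by ring.
    apply: ler_wpM2l (rnorm_ge0 f) _ _ _.
    have := Abd _ Ag; rewrite gE => /le_trans; apply.
    rewrite ler_wpM2r ?rnorm_ge0//.
    by have := ler_norm c; rewrite /k; lra.
  have := rnorm_ge0 f; rewrite le_eqVlt => /predU1P[f0 _|f0 sE].
    by rewrite (rnorm_eq0 (esym f0)) rnorm0 expr0n/= mulr0 rip0r.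
  have f2 : 0 < rnorm f ^+ 2 by rewrite exprn_gt0.
  have : rnorm f ^+ 2 <= k * s f f.
    rewrite -(ler_pM2r f2) -expr2; apply: le_trans sE _.
    have -> : k * s f f * rnorm f ^+ 2 = s f f * (k * rnorm f ^+ 2) by ring.
    by rewrite ler_wpM2l// sff.
  rewrite -ler_pdivrMl// /s ripxx; lra.
have : E (Num.min (m + k^-1) mu).
  split=> [|f Af]; first by rewrite ge_min lexx orbT.
  by apply: le_trans (better f Af); rewrite ler_wpM2r ?sqr_ge0// ge_min lexx.
move=> /(sup_upper_bound hE); rewrite -/m leNgt lt_min ltm andbT ltrDl invr_gt0 k0.
by [].
Qed.

End SelfAdjoint.

Lemma bounded_from_belowP (R : realType) (H : hilbertType R) (A : op H H) :
  bounded_from_below A ->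
  exists c : R, forall x, dom A x -> c * rnorm x ^+ 2 <= rip (A x) x.
Proof.
move=> [c Ac]; exists c => x /Ac; rewrite lecE innerxx => /andP[_].
by rewrite /rip /= mulr0 subr0.
Qed.

(** * Numerical range and spectrum *)

Section NumericalRange.
Variables (R : realType) (H : hilbertType R) (A : op H H).
Hypothesis A_lin : linear_op A.
Implicit Types (u w z : R[i]) (c d : R).

Lemma numerical_range_scale f : dom A f -> f != 0 ->
  exists2 z, numerical_range A z & '[A f, f] = (rnorm f ^+ 2)%:C * z.
Proof.
move=> Af f0; have f1 := rnorm_gt0 f0; pose g := (rnorm f)^-1%:C *: f.
exists '[A g, g].
  exists g => //; split; first exact: (linear_on_domZ A_lin).
  by rewrite /mkset /g rnormZr gtr0_norm ?invr_gt0// mulVf ?gt_eqF.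
rewrite (linear_onZ A_lin)// innerZl innerZr conjc_real !mulrA -!rmorphM/=.
have -> : rnorm f ^+ 2 * (rnorm f)^-1 * (rnorm f)^-1 = 1 by field; rewrite gt_eqF.
by rewrite mul1r.
Qed.

Lemma numerical_range_le u c :
  (forall z, numerical_range A z -> complex.Re (u * z) <= c) ->
  forall f, dom A f -> complex.Re (u * '[A f, f]) <= c * rnorm f ^+ 2.
Proof.
move=> Wc f Af; have [->|f0] := eqVneq f 0.
  by rewrite rnorm0 expr0n/= mulr0 innerE !(scaler0, rip0r) mulr0.
have [z /Wc zc ->] := numerical_range_scale Af f0.
have : 0 <= rnorm f ^+ 2 by exact: sqr_ge0.
rewrite mulrCA; move: zc; case: (u * z) => a b /=.
rewrite mul0r subr0 [c * _]mulrC => ac n0; exact: ler_wpM2l.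
Qed.

(** The part of membership in the resolvent set that has to be propagated: in an open half-plane off
    the numerical range the lower bound for [|A f - w f|] comes by itself. *)
Definition onto w := forall g, exists2 f, dom A f & A f - w *: f = g.

Lemma resolvent_onto w : resolvent_set A w -> onto w.
Proof. by move=> [[_ _ Asurj] _] g; have [f Af fE] := Asurj g I; exists f. Qed.

Lemma onto_resolvent w d : 0 < d ->
  (forall f, dom A f -> d * rnorm f <= rnorm (A f - w *: f)) ->
  onto w -> resolvent_set A w.
Proof.
move=> d0 Ad Aw; split; last first.
  exists d^-1 => f Af; rewrite mulrC ler_pdivlMr// mulrC; exact: Ad.
split=> // [f g|g _]; last by have [f Af fE] := Aw g; exists f.
rewrite !inE => Af Ag E; apply/eqP; rewrite -subr_eq0; apply/eqP/rnorm_eq0/eqP.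
rewrite eq_le rnorm_ge0 andbT -(ler_pM2l d0) mulr0.
apply: le_trans (Ad _ (linear_on_domB A_lin Af Ag)) _.
rewrite (linear_onB A_lin)// scalerBr opprD addrACA -opprD.
by have /= -> := E; rewrite subrr rnorm0.
Qed.

(* The Neumann series, as a fixed point. *)
Lemma onto_near w0 w d : (forall f, dom A f -> d * rnorm f <= rnorm (A f - w0 *: f)) ->
  onto w0 -> rnorm (w - w0 : R[i]^o) < d -> onto w.
Proof.
move=> Ad Aw0 wd g; have d0 : 0 < d := le_lt_trans (rnorm_ge0 _) wd.
have /choice[P PP] h : exists f, dom A f /\ A f - w0 *: f = h.
  by have [f Af fE] := Aw0 h; exists f.
have [|||h hE] := @contraction_fixed R H (fun h => g + (w - w0) *: P h)
    (rnorm (w - w0 : R[i]^o) / d).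
- by rewrite divr_ge0 ?rnorm_ge0// ltW.
- by rewrite ltr_pdivrMr// mul1r.
- move=> h k; rewrite opprD addrACA subrr add0r -scalerBr rnormZ -mulrA.
  rewrite ler_wpM2l ?rnorm_ge0// mulrC ler_pdivlMr// mulrC.
  have [[Ah hE] [Ak kE]] := (PP h, PP k).
  apply: le_trans (Ad _ (linear_on_domB A_lin Ah Ak)) _.
  by rewrite (linear_onB A_lin)// scalerBr opprD addrACA -opprD hE kE.
have [Ah /eqP] := PP h; rewrite subr_eq => /eqP AE; exists (P h) => //.
have hE' : h = g + (w - w0) *: P h by exact: esym hE.
move: AE hE'; move: (P h) => f -> ->.
by rewrite scalerBl addrA subrK addrK.
Qed.

(** The numerical range bounds [|A f - w f|] below by [d / k] times [|f|], uniformly for [w] on the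
    segment from [w0] to [w1]. The segment is cut into [N + 1] steps shorter than [d / k], and
    [onto_near] carries surjectivity across each. *)
Lemma half_plane_resolvent u c w0 w1 :
  (forall z, numerical_range A z -> complex.Re (u * z) <= c) ->
  c < complex.Re (u * w0) -> c < complex.Re (u * w1) ->
  onto w0 -> resolvent_set A w1.
Proof.
move=> /numerical_range_le Wc cw0 cw1 Aw0.
pose d := Num.min (complex.Re (u * w0)) (complex.Re (u * w1)) - c.
have d0 : 0 < d by rewrite subr_gt0 lt_min cw0.
pose k := rnorm (u : R[i]^o) + 1; have k0 : 0 < k by rewrite ltr_wpDl ?rnorm_ge0.
have low w f : c + d <= complex.Re (u * w) -> dom A f ->
    d / k * rnorm f <= rnorm (A f - w *: f).
  move=> wd Af; rewrite mulrAC ler_pdivrMr//.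
  have := rnorm_ge0 f; rewrite le_eqVlt => /predU1P[<-|f0].
    by rewrite mulr0 mulr_ge0 ?rnorm_ge0// ltW.
  rewrite -(ler_pM2r f0); have := Wc f Af => h1.
  have := rip_le (u *: (w *: f - A f)) f; rewrite rnormZ rnormB => h2.
  have : rip (u *: (w *: f - A f)) f =
      complex.Re (u * w) * rnorm f ^+ 2 - complex.Re (u * '[A f, f]).
    rewrite /rip innerZl innerBl innerZl mulrBr raddfB/= mulrA innerxx; congr (_ - _).
    by case: (u * w) => a b /=; ring.
  move=> h3; have f2 : 0 <= rnorm f ^+ 2 by exact: sqr_ge0.
  have : (c + d) * rnorm f ^+ 2 <= complex.Re (u * w) * rnorm f ^+ 2 by exact: ler_wpM2r.
  have : 0 <= rnorm (A f - w *: f) * rnorm f by rewrite mulr_ge0 ?rnorm_ge0.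
  by rewrite /k; lra.
have dk : 0 < d / k by rewrite divr_gt0.
pose l := rnorm (w1 - w0 : R[i]^o).
have [N NP] : exists N : nat, l / N.+1%:R < d / k.
  have l0 : 0 < l + 1 by rewrite ltr_wpDl ?rnorm_ge0.
  have [N /(_ N (leqnn _)) NP] := invS_small (divr_gt0 dk l0).
  exists N; move: NP; rewrite ltr_pdivlMr// mulrC; apply: le_lt_trans.
  by rewrite ler_pM2r ?invr_gt0// lerDl.
pose v n := w0 + (n%:R / N.+1%:R)%:C * (w1 - w0).
have Rv n : (n <= N.+1)%N -> c + d <= complex.Re (u * v n).
  move=> nN; pose t := n%:R / N.+1%:R : R.
  have t0 : 0 <= t by rewrite divr_ge0.
  have t1 : t <= 1 by rewrite ler_pdivrMr// mul1r ler_nat.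
  have -> : complex.Re (u * v n) = (1 - t) * complex.Re (u * w0) + t * complex.Re (u * w1).
    rewrite /v -/t; case: (u) (w0) (w1) => [a b] [x y] [x1 y1] /=; ring.
  have m0 : c + d <= complex.Re (u * w0) by rewrite addrC subrK ge_min lexx.
  have m1 : c + d <= complex.Re (u * w1) by rewrite addrC subrK ge_min lexx orbT.
  by nra.
have onv n : (n <= N.+1)%N -> onto (v n).
  elim: n => [_|n IH nN]; first by rewrite /v mul0r rmorph0 mul0r addr0.
  apply: (@onto_near (v n) _ (d / k)); last 1 first.
  - have -> : v n.+1 - v n = (N.+1%:R^-1)%:C * (w1 - w0).
      rewrite /v opprD addrACA subrr add0r -mulrBl -rmorphB/=.
      by rewrite -mulrBl -natrB// subSnn mul1r.
    by rewrite (rnormZr (V := R[i]^o)) ger0_norm ?invr_ge0// mulrC.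
  - by move=> f; apply: low; apply: Rv; exact: ltnW.
  - by apply: IH; exact: ltnW.
have e1 : N.+1%:R / N.+1%:R = 1 :> R by rewrite divff// pnatr_eq0.
have <- : v N.+1 = w1 by rewrite /v e1 rmorph1 mul1r addrC subrK.
apply: onto_resolvent dk _ (onv _ (leqnn _)).
by move=> f; apply: low; exact: Rv.
Qed.

(* Toeplitz-Hausdorff: on the span of [x] and [y] the form, normalised to
   take the values 0 at x and 1 at y, becomes real along [x + s (om y)] for a
   suitable complex [om], and takes each value of [0, 1] at some real [s]. *)
Lemma numerical_range_convex z1 z2 (t : R) : numerical_range A z1 ->
  numerical_range A z2 -> 0 <= t -> t <= 1 ->
  numerical_range A (z1 + t%:C * (z2 - z1)).
Proof.
move=> W1 W2 t0 t1.
have [<-|z12] := eqVneq z1 z2; first by rewrite subrr mulr0 addr0.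
move: t0; rewrite le_eqVlt => /predU1P[<-|t0]; first by rewrite rmorph0 mul0r addr0.
move: t1; rewrite le_eqVlt => /predU1P[->|t1]; first by rewrite rmorph1 mul1r addrC subrK.
case: W1 W2 => x [Ax /= x1] xE [y [Ay /= y1] yE].
pose gm := z2 - z1; have gm0 : gm != 0 by rewrite subr_eq0 eq_sym.
pose p := ('[A x, y] - z1 * '[x, y]) / gm; pose q := ('[A y, x] - z1 * '[y, x]) / gm.
(* Taking for [om] the difference of [p] and the conjugate of [q] makes the cross term
   [|p|^2 - |q|^2]. If this difference is [0], then [p + q] is already real and [om = 1] will do. *)
have [om om0 [c cE]] : exists2 om : R[i], om != 0 &
    exists c : R, om^*%C * p + om * q = c%:C.
  case: p q => [p1 p2] [q1 q2].
  have [/andP[/eqP e1 /eqP e2]|] := boolP ((p1 == q1) && (p2 == - q2)).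
    exists 1; first exact: oner_neq0.
    exists (p1 + q1); rewrite conjc1 !mul1r e1 e2.
    by apply/eqP; rewrite eq_complex/= addNr !eqxx.
  move=> pq; exists ((p1 - q1) +i* (p2 + q2)).
    apply: contra pq; rewrite eq_complex/= subr_eq0 addr_eq0 => /andP[-> /eqP ->].
    by rewrite eqxx.
  exists ((p1 - q1) * p1 + (p2 + q2) * p2 + ((p1 - q1) * q1 - (p2 + q2) * q2)).
  by apply/eqP; rewrite eq_complex/=; apply/andP; split; apply/eqP; ring.
pose m := rnorm (om : R[i]^o) ^+ 2.
have m0 : 0 < m by rewrite exprn_gt0// rnorm_gt0.
have mE : om * om^*%C = m%:C by rewrite -sqr_normc /m rmorphXn/= -rnormE.
pose d := rip x (om *: y).
pose a := m * (1 - t); have a0 : 0 < a by rewrite mulr_gt0// subr_gt0.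
pose e := c - 2 * t * d.
(* This is [s c + s^2 m = t |f|^2] with [|f|^2 = 1 + 2 s d + s^2 m]: the normalised form at
   [f = x + s om y] is to take the value [t]. It has a real root because [a t > 0]. *)
have [s sE] : exists s : R, a * s ^+ 2 + e * s - t = 0.
  have D0 : 0 <= e ^+ 2 + 4 * a * t by have := sqr_ge0 e; have := mulr_gt0 a0 t0; lra.
  exists ((- e + Num.sqrt (e ^+ 2 + 4 * a * t)) / (2 * a)).
  have := sqr_sqrtr D0; set r := Num.sqrt _ => rE.
  have -> : a * ((- e + r) / (2 * a)) ^+ 2 + e * ((- e + r) / (2 * a)) - t =
      (r ^+ 2 - (e ^+ 2 + 4 * a * t)) / (4 * a) by field; rewrite gt_eqF.
  by rewrite rE subrr mul0r.
pose k := s%:C * om; pose f := k *: y + x.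
have Af : dom A f by exact: (linear_on_domP A_lin).
have kC : k^*%C = s%:C * om^*%C.
  rewrite /k; case: (om) => a' b'; apply/eqP; rewrite eq_complex/=.
  by apply/andP; split; apply/eqP; ring.
have kk : k * k^*%C = (s ^+ 2 * m)%:C.
  by rewrite kC /k mulrACA mE -!rmorphM/= expr2.
have fn : rnorm f ^+ 2 = 1 + 2 * s * d + s ^+ 2 * m.
  apply: complexI; rewrite -innerxx /f /k -scalerA.
  have := rnormD_sqr (s%:C *: (om *: y)) x; rewrite -ripxx => E.
  rewrite innerxx -ripxx E x1 rnormZr rnormZ y1 ripZl ripC mulr1 exprMn real_normK ?num_real//.
  by rewrite -/m -/d; congr (_%:C); ring.
have fE : '[A f, f] = (rnorm f ^+ 2)%:C * (z1 + t%:C * gm).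
  have -> : '[A f, f] = z1 * '[f, f] + gm * (k^*%C * p + k * q + k * k^*%C).
    rewrite /f (linear_onP A_lin)// !innerDl !innerDr !innerZl !innerZr xE yE !innerxx x1 y1.
    rewrite expr1n rmorph1 /p /q /gm.
    by field; rewrite subr_eq0 eq_sym.
  have -> : k^*%C * p + k * q = (s * c)%:C.
    by rewrite kC rmorphM/= -cE /k; ring.
  rewrite kk innerxx -rmorphD/= mulrDr [z1 * _]mulrC; congr (_ + _).
  rewrite mulrA -rmorphM/= [RHS]mulrC; congr (_ * _%:C).
  by rewrite fn; move: sE; rewrite /a /e; lra.
have f0 : f != 0.
  apply/eqP => f0; have xy : x = - k *: y.
    by apply/eqP; rewrite scaleNr -addr_eq0 addrC -/f f0.
  have k1 : k * k^*%C = 1.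
    have := innerxx x; rewrite x1 {1 2}xy innerZl innerZr innerxx y1 expr1n mulr1.
    by rewrite rmorphN mulrNN rmorph1.
  case/eqP: z12; rewrite -xE -yE {1 2}xy (linear_onZ A_lin)// innerZl innerZr mulrA.
  by rewrite rmorphN mulrNN k1 mul1r.
have [z Wz zE] := numerical_range_scale Af f0.
have fn0 : (rnorm f ^+ 2)%:C != 0.
  by rewrite (inj_eq (@complexI R) _ 0) expf_neq0// gt_eqF// rnorm_gt0.
rewrite fE in zE; suff -> : z1 + t%:C * (z2 - z1) = z by [].
exact: (mulfI fn0 zE).
Qed.

(** The plane is embedded in [H] as the multiples of a unit vector [h], so that the convex
    projection in [H] applies. With [p] the point of [X] nearest to [z *: h], the separating
    functional is the pairing with [z *: h - p]. *)
Lemma numerical_range_separation z :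
  ~ closure (numerical_range A : set R[i]^o) z -> numerical_range A !=set0 ->
  exists u c, (forall w, numerical_range A w -> complex.Re (u * w) <= c) /\
    c < complex.Re (u * z).
Proof.
move=> clz [w0 Ww0].
have [e e0 ze] : exists2 e : R, 0 < e & forall w, numerical_range A w ->
    e <= rnorm (z - w : R[i]^o).
  apply: contrapT => H0; apply/clz/closureP => e e0; apply: contrapT => H1.
  apply: H0; exists e => // w Ww; rewrite leNgt; apply/negP => zw.
  by apply: H1; exists w.
have [h [_ /= h1] _] := Ww0.
pose X : set H := [set p | forall r : R, 0 < r -> exists2 w, numerical_range A w &
  rnorm (p - w *: h) < r].
have WX w : numerical_range A w -> X (w *: h).
  by move=> Ww r r0; exists w; rewrite // subrr rnorm0.
have [|x y t Xx Xy t0 t1 r r0|p pX r r0|p Xp pP] := @convex_projection R H X _ _ _ (z *: h).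
- by exists (w0 *: h); exact: WX.
- have [[w Ww xw] [v Wv yv]] := (Xx _ r0, Xy _ r0).
  exists (w + t%:C * (v - w)); first exact: numerical_range_convex.
  have -> : x + t%:C *: (y - x) - (w + t%:C * (v - w)) *: h =
      (1 - t)%:C *: (x - w *: h) + t%:C *: (y - v *: h).
    rewrite scalerDl -scalerA scalerBl.
    by apply: rip_ext => g; rewrite !ripE; ring.
  apply: le_lt_trans (ler_rnormD _ _) _; rewrite !rnormZr !ger0_norm ?subr_ge0//.
  move: (rnorm (x - w *: h)) (rnorm (y - v *: h)) xw yv => a b ar br.
  apply: (@le_lt_trans _ _ (Num.max a b)); last by rewrite gt_max ar br.
  have k1 : (1 - t) * a <= (1 - t) * Num.max a b.
    by rewrite ler_wpM2l ?subr_ge0// le_max lexx.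
  have k2 : t * b <= t * Num.max a b by rewrite ler_wpM2l// le_max lexx orbT.
  by lra.
- have r2 : 0 < r / 2 by rewrite divr_gt0.
  have [x Xx px] := pX _ r2; have [w Ww xw] := Xx _ r2; exists w => //.
  by apply: le_lt_trans (ler_rnormDist x _ _) _; lra.
pose y := z *: h - p.
have uE w : complex.Re ('[h, y] * w) = rip (w *: h) y by rewrite /rip innerZl mulrC.
exists '[h, y], (rip p y); split=> [w Ww|].
  by have := pP _ (WX _ Ww); rewrite ripBl subr_le0 uE.
rewrite uE -subr_gt0 -ripBl ripxx exprn_gt0// rnorm_gt0//.
rewrite subr_eq0; apply/eqP => zp.
have [w Ww] := Xp _ e0; rewrite -zp -scalerBl rnormZ h1 mulr1.
by rewrite ltNge ze.
Qed.

Lemma spectrum_numerical_range : m_sectorial A ->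
  spectrum A `<=` closure (numerical_range A : set R[i]^o).
Proof.
move=> [eta [kp [kp0 Wsec [w0 [w0sec w0res]]]]] z zs; apply: contrapT => clz; apply: zs.
have A0 := resolvent_onto w0res.
(* With an empty numerical range every half-plane misses it; the one chosen contains both [w0] and
   [z]. *)
have [We|Wne] := eqVneq (numerical_range A) set0.
  pose c := Num.min (complex.Re w0) (complex.Re z) - 1.
  apply: (@half_plane_resolvent 1 c w0); rewrite ?mul1r ?We//.
  - by rewrite /c ltrBlDr (@le_lt_trans _ _ (complex.Re w0)) ?ge_min ?lexx// ltrDl.
  - by rewrite /c ltrBlDr (@le_lt_trans _ _ (complex.Re z)) ?ge_min ?lexx ?orbT// ltrDl.
have [u [c [Wu cz]]] := numerical_range_separation clz ((set0P _).1 Wne).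
(* The complement of the sector is the union of the three open half-planes given by [h1], [h2] and
   [h3]. The point [ws], to the left of the vertex, lies in all of them, hence shares one with
   [w0]. *)
have h1 w : numerical_range A w -> complex.Re (-1 * w) <= - eta.
  by move=> /Wsec[]; rewrite mulN1r raddfN/= lerN2.
have h2 w : numerical_range A w -> complex.Re (((- kp) +i* (-1)) * w) <= - kp * eta.
  move=> /Wsec[_]; rewrite ler_norml => /andP[_]; case: w => a b /=; lra.
have h3 w : numerical_range A w -> complex.Re (((- kp) +i* 1) * w) <= - kp * eta.
  move=> /Wsec[_]; rewrite ler_norml => /andP[+ _]; case: w => a b /=; lra.
pose ws : R[i] := (eta - 1)%:C.
have s1 : - eta < complex.Re (-1 * ws) by rewrite mulN1r/=; lra.
have s2 : - kp * eta < complex.Re (((- kp) +i* (-1)) * ws) by rewrite /=; nra.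
have s3 : - kp * eta < complex.Re (((- kp) +i* 1) * ws) by rewrite /=; nra.
have Aws : onto ws.
  apply: resolvent_onto.
  have [r1|r1] := ltP (complex.Re w0) eta.
    by apply: (half_plane_resolvent h1 _ s1 A0); rewrite mulN1r raddfN/= ltrN2.
  have : kp * (complex.Re w0 - eta) < `|complex.Im w0|.
    by rewrite ltNge; apply/negP => r2; apply: w0sec.
  rewrite ltr_normr => /orP[] r2.
    by apply: (half_plane_resolvent h2 _ s2 A0); case: (w0) r2 => a b /=; lra.
  by apply: (half_plane_resolvent h3 _ s3 A0); case: (w0) r2 => a b /=; lra.
(* From [ws] one moves along [v], inside the half-plane of [u'], until the half-plane of [u] is
   entered; from there [z] is reached. *)
have reach v u' c' : (forall w, numerical_range A w -> complex.Re (u' * w) <= c') ->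
    c' < complex.Re (u' * ws) -> 0 <= complex.Re (u' * v) -> 0 < complex.Re (u * v) ->
    resolvent_set A z.
  move=> Wu' c'ws u'v uv.
  pose s := (`|c - complex.Re (u * ws)| + 1) / complex.Re (u * v).
  have s0 : 0 <= s by rewrite divr_ge0 ?addr_ge0// ltW.
  have RE (x : R[i]) : complex.Re (x * (ws + s%:C * v)) =
      complex.Re (x * ws) + s * complex.Re (x * v).
    by case: (x) (ws) (v) => [a b] [a1 b1] [a2 b2] /=; ring.
  apply: (half_plane_resolvent Wu _ cz (w0 := ws + s%:C * v)).
    rewrite RE divfK ?gt_eqF//.
    by have := ler_norm (c - complex.Re (u * ws)); lra.
  apply: resolvent_onto; apply: (half_plane_resolvent Wu' c'ws _ Aws).
  by rewrite RE; apply: lt_le_trans c'ws _; rewrite lerDl mulr_ge0.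
(* The direction points left, or up or down more steeply than the slope [kp], according to the signs
   of [a] and [b]. The case [u = 0] contradicts the presence of a point in the numerical range. *)
case: u Wu cz reach => a b Wu cz reach.
have [a0|a0] := ltP a 0.
  by apply: (reach (-1) _ _ h1 s1) => /=; lra.
have [b0|b0] := ltP b 0.
  by apply: (reach (1 +i* (kp + 1)) _ _ h2 s2) => /=; nra.
apply: (reach (1 +i* (- (kp + 1))) _ _ h3 s3) => /=; first lra.
have [b1|b1] := ltP 0 b; first by nra.
have bE : b = 0 by apply/eqP; rewrite eq_le b0 b1.
have [a1|a1] := ltP 0 a; first by rewrite bE; lra.
have aE : a = 0 by apply/eqP; rewrite eq_le a0 a1.
have [w Ww] := (set0P _).1 Wne.
have := Wu _ Ww; move: cz; rewrite aE bE; case: (z) (w) => [? ?] [? ?] /=.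
by rewrite !mul0r subr0 => /lt_le_trans H0 /H0; rewrite ltxx.
Qed.

End NumericalRange.

(** * Extension by density and the operator square root *)

Lemma dense_extension (R : realType) (U : normedModType R[i])
    (V : completeNormedModType R[i]) (A : op U V) (K : R) :
  linear_op A -> densely_defined A ->
  (forall x, dom A x -> rnorm (A x) <= K * rnorm x) ->
  forall x, exists y, closure (graph A) (x, y).
Proof.
move=> lA /dense_rnormP dA AK x.
have /choice[u uP] (n : nat) : exists v, dom A v /\ rnorm (x - v) < n.+1%:R^-1.
  by have [|v Av xv] := dA x n.+1%:R^-1; [rewrite invr_gt0 | exists v].
pose k := `|K| + 1; have k0 : 0 < k by rewrite ltr_wpDl.
have uC (e : R) : 0 < e -> exists N, forall m n, (N <= m)%N -> (N <= n)%N ->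
    rnorm (A (u m) - A (u n)) < e.
  move=> e0; have e2 : 0 < e / 2 / k by rewrite !divr_gt0.
  have [N sN] := invS_small e2; exists N => m n Nm Nn.
  have [[Am um] [An un]] := (uP m, uP n).
  rewrite -(linear_onB lA)//; apply: le_lt_trans (AK _ (linear_on_domB lA Am An)) _.
  have uu : rnorm (u m - u n) < e / k.
    apply: le_lt_trans (ler_rnormDist x _ _) _.
    rewrite rnormB; apply: lt_trans (ltrD um un) _.
    by apply: lt_le_trans (ltrD (sN _ Nm) (sN _ Nn)) _; rewrite -mulrDl -splitr.
  apply: (@le_lt_trans _ _ (k * rnorm (u m - u n))).
    by rewrite ler_wpM2r ?rnorm_ge0// (le_trans (ler_norm K))// /k lerDl.
  by rewrite mulrC -ltr_pdivlMr.
have [y yP] := rnorm_complete uC; exists y; apply/closure_graphP => e e0.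
have [N1 H1] := yP _ e0; have [N2 H2] := invS_small e0.
have [Au xu] := uP (maxn N1 N2).
exists (u (maxn N1 N2)); split=> //.
  by apply: lt_trans xu _; apply: H2; exact: leq_maxr.
by rewrite rnormB; apply: H1; exact: leq_maxl.
Qed.

Section SqrtOp.
Variables (R : realType) (G : hilbertType R).

Lemma self_adjoint_setT (F : G -> G) : (forall x y, '[F x, y] = '[x, F y]) ->
  self_adjoint (Op setT F).
Proof.
move=> sF; have dT : densely_defined (Op setT F).
  by move=> O [x Ox] _; exists x.
have adjE x : dom (adjoint (Op setT F)) x /\ adjoint (Op setT F) x = F x.
  by apply: adjoint_eq => // z _ /=.
split=> //; apply/seteqP; split=> -[x y] [_ yE]; have [xd xE] := adjE x; split=> //.
  exact: etrans yE (esym xE).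
exact: etrans yE xE.
Qed.

(** The root built by iteration shows that the choice in [sqrt_op] picks a genuine root, which is
    everywhere defined because its square is. *)
Lemma sqrt_opP (A : op G G) (k : R) : 0 < k -> (forall x, dom A x) ->
  (forall x y, '[A x, y] = '[x, A y]) -> (forall x, 0 <= rip (A x) x) ->
  (forall x, rip (A x) x <= k * rnorm x ^+ 2) ->
  [/\ forall x, dom (sqrt_op A) x,
      forall x y, '[sqrt_op A x, y] = '[x, sqrt_op A y]
    & forall x, sqrt_op A (sqrt_op A x) = A x].
Proof.
move=> k0 dA sA pA Ak; have [Q [sQ pQ QQ]] := positive_sqrt sA pA k0 Ak.
have [|sq_sa _ sqsq] := @xgetPex _ A
  [set Q | [/\ self_adjoint Q, nonnegative_op Q & eqop (comp_op Q Q) A]].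
  exists (Op setT Q); split; first exact: self_adjoint_setT.
    (* The order on [R[i]] also demands that [(Q x, x)] be real, which follows from symmetry. *)
    move=> x _; rewrite lecE; apply/andP; split; last exact: pQ.
    change (complex.Im '[Q x, x] == 0).
    have : '[Q x, x] = ('[Q x, x])^*%C by rewrite -innerC sQ.
    by case: '[Q x, x] => a b [] E; apply/eqP; move: E => /=; lra.
  apply/seteqP; split=> -[x y] [_ yE]; split.
  - exact: dA.
  - exact: etrans yE (QQ x).
  - by [].
  - exact: etrans yE (esym (QQ x)).
rewrite -/(sqrt_op A) in sq_sa sqsq.
have sqP x : graph (comp_op (sqrt_op A) (sqrt_op A)) (x, A x) by rewrite sqsq.
have sd x : dom (sqrt_op A) x by have [[]] := sqP x.
split=> // [x y|x]; first exact: self_adjoint_sym.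
by have [] := sqP x.
Qed.

End SqrtOp.

(** * Quasi boundary triples *)

Section Triple.
Variables (R : realType) (H G : hilbertType R) (S T : op H H) (G0 G1 : H -> G).
Hypothesis triple : quasi_boundary_triple T G0 G1 S.

Let T_lin := qbt_linear triple.
Let G0_lin := qbt_linear0 triple.
Let G1_lin := qbt_linear1 triple.
Local Notation A0 := (ker_restrict T G0).
Local Notation A1 := (ker_restrict T G1).

Lemma green_rip f g : dom T f -> dom T g ->
  rip (T f) g - rip f (T g) = rip (G1 f) (G0 g) - rip (G0 f) (G1 g).
Proof.
by move=> Tf Tg; rewrite /rip -!raddfB/= (qbt_green triple Tf Tg).
Qed.

Lemma dense_boundary0 : dense (G0 @` dom T).
Proof.
apply/dense_rnormP => x e e0.
have [_ [f Tf <-] [/= xf _]] := dense_pairP (qbt_dense triple) x 0 e0.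
by exists (G0 f) => //; exists f.
Qed.

Lemma dense_boundary1 : dense (G1 @` dom T).
Proof.
apply/dense_rnormP => x e e0.
have [_ [f Tf <-] [/= _ xf]] := dense_pairP (qbt_dense triple) 0 x e0.
by exists (G1 f) => //; exists f.
Qed.

Lemma eigen_kerB l f g : eigen_ker T l f -> eigen_ker T l g -> eigen_ker T l (f - g).
Proof.
move=> [Tf fE] [Tg gE]; split; first exact: (linear_on_domB T_lin).
by rewrite (linear_onB T_lin)// fE gE scalerBr.
Qed.

Lemma eigen_kerP l a f g : eigen_ker T l f -> eigen_ker T l g ->
  eigen_ker T l (a *: f + g).
Proof.
move=> [Tf fE] [Tg gE]; split; first exact: (linear_on_domP T_lin).
by rewrite (linear_onP T_lin)// fE gE scalerDr !scalerA mulrC.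
Qed.

(** Subtracting from [f] the solution [f0] of [(T - l) f0 = (T - l) f] in [ker G'] leaves an element
    of [ker (T - l)]. Applied to [G0] and to [G1]. *)
Lemma eigen_complement (G' : H -> G) l f : linear_on (dom T) G' ->
  onto (ker_restrict T G') l -> dom T f ->
  exists2 g, eigen_ker T l g & G' g = G' f.
Proof.
move=> lG' oA Tf; have [f0 [Tf0 /= Gf0] f0E] := oA (T f - l *: f).
exists (f - f0); last by rewrite (linear_onB lG')// Gf0 subr0.
split; first exact: (linear_on_domB T_lin).
rewrite (linear_onB T_lin)// scalerBr; move: f0E => /= /eqP.
by rewrite subr_eq => /eqP ->; rewrite opprD opprB addrA addrCA subrr addr0.
Qed.

Variable mu : R.
Hypothesis A0_onto : forall l : R, l < mu -> resolvent_set A0 l%:C.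
Hypothesis A0_ge : forall f, dom A0 f -> mu * rnorm f ^+ 2 <= rip (A0 f) f.

Lemma eigen_inj (l : R) g : l < mu -> eigen_ker T l%:C g -> G0 g = 0 -> g = 0.
Proof.
move=> lmu [Tg gE] g0; have := A0_ge (conj Tg g0); rewrite /= gE ripZl ripxx => h.
apply: rnorm_eq0; apply/eqP; apply: contraTT h => g1.
by rewrite -ltNge ltr_pM2r// exprn_gt0// lt_neqAle eq_sym g1 rnorm_ge0.
Qed.

Lemma weylE (l : R) g : l < mu -> eigen_ker T l%:C g ->
  weyl T G0 G1 l%:C (G0 g) = G1 g.
Proof.
move=> lmu gk; rewrite /weyl /=; congr G1.
apply: xget_subset1 => // h k [hk hE] [kk kE]; apply/eqP; rewrite -subr_eq0; apply/eqP.
apply: (eigen_inj lmu); first exact: eigen_kerB.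
by rewrite (linear_onB G0_lin) ?hE ?kE ?subrr//; [case: hk | case: kk].
Qed.

Lemma weyl_linear (l : R) : l < mu -> linear_op (weyl T G0 G1 l%:C).
Proof.
move=> lmu; split.
  exists 0; last exact: (linear_on0 G0_lin).
  split; first exact: (linear_on_dom0 T_lin).
  by rewrite (linear_on0 T_lin) scaler0.
move=> a _ _ [f fk <-] [g gk <-].
have [Tf fE] := fk; have [Tg gE] := gk.
rewrite -(linear_onP G0_lin)//; have fgk := eigen_kerP a fk gk; split.
  by exists (a *: f + g).
by rewrite !weylE// (linear_onP G1_lin).
Qed.

Lemma weyl_dense (l : R) : l < mu -> densely_defined (weyl T G0 G1 l%:C).
Proof.
move=> lmu; rewrite /densely_defined.
suff -> : dom (weyl T G0 G1 l%:C) = G0 @` dom T by exact: dense_boundary0.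
apply/seteqP; split=> [_ [g [Tg _] <-]|_ [f Tf <-]]; first by exists g.
have [g gk gE] := eigen_complement G0_lin (resolvent_onto (A0_onto lmu)) Tf.
by exists g.
Qed.

Lemma weyl_sym (l : R) f g : eigen_ker T l%:C f -> eigen_ker T l%:C g ->
  '[G1 f, G0 g] = '[G0 f, G1 g].
Proof.
move=> [Tf fE] [Tg gE]; apply/eqP; rewrite -subr_eq0 -(qbt_green triple Tf Tg).
by rewrite fE gE innerZl innerZr conjc_real subrr.
Qed.

(** A densely defined symmetric operator is closable. *)
Lemma weyl_closable (l : R) : l < mu -> closable (weyl T G0 G1 l%:C).
Proof.
move=> lmu y /closure_graphP yP; apply: (dense_rip0 (weyl_dense lmu)) => _ [g gk <-].
suff -> : rip y (G0 g) = rip 0 (G1 g) by exact: rip0l.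
apply: rip_limit => e /yP[_ [[f fk <-] xf yf]]; rewrite weylE// in yf.
by exists (G1 f), (G0 f); split=> //; rewrite /rip (weyl_sym fk gk).
Qed.

(** The real part of [((T - l) f, g) + (G0 f, G1 g)] at [g = f]; the boundary term makes this form
    hermitian, by Green's identity. It is the form of [A0 - l] on [ker G0], of [A1 - l] on [ker G1],
    and [(M(l) phi, phi)] on [ker (T - l)], where [phi = G0 f]. *)
Definition form (l : R) (f : H) : R := rip (T f - l%:C *: f) f + rip (G0 f) (G1 f).

Section Decay.
Variables (beta C : R).
Hypotheses (beta_gt0 : 0 < beta) (C_gt0 : 0 < C).
Hypothesis M_decay : forall l : R, l < mu ->
  (opnorm (closure_op (weyl T G0 G1 l%:C)) <= (C / ((mu - l) `^ beta))%:E)%E.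

Lemma decay_gt0 (l : R) : l < mu -> 0 < C / ((mu - l) `^ beta).
Proof. by move=> lmu; rewrite divr_gt0// powR_gt0// subr_gt0. Qed.

Lemma eigen_bound (l : R) g : l < mu -> eigen_ker T l%:C g ->
  rnorm (G1 g) <= C / ((mu - l) `^ beta) * rnorm (G0 g).
Proof.
move=> lmu gk; rewrite -(weylE lmu gk).
apply: (opnorm_bound (weyl_linear lmu) (weyl_closable lmu) (M_decay lmu)).
by exists g.
Qed.

Lemma decay_small (c e : R) : 0 < e -> exists2 l : R, l < c & C / ((mu - l) `^ beta) < e.
Proof.
(* [x] solves [C / x^beta = e]; the final [- 1] makes both inequalities strict. *)
move=> e0; pose x := (C / e) `^ beta^-1.
exists (Num.min c (mu - x) - 1).
  by rewrite ltrBlDr (@le_lt_trans _ _ c)// ?ge_min ?lexx// ltrDl.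
set l := _ - 1; have xl : x < mu - l.
  rewrite /l; have : Num.min c (mu - x) <= mu - x by rewrite ge_min lexx orbT.
  by lra.
have x0 : 0 <= x by exact: powR_ge0.
have xb : x `^ beta = C / e.
  by rewrite /x -powRrM mulVf ?gt_eqF// powRr1// divr_ge0// ltW.
have : C / e < (mu - l) `^ beta.
  by rewrite -xb gt0_ltr_powR// nnegrE// (le_trans x0)// ltW.
rewrite ltr_pdivrMr// => h; rewrite ltr_pdivrMr 1?mulrC//.
by rewrite powR_gt0// (le_lt_trans x0).
Qed.

(* Splitting [f = F + g] with [F] in the domain of [A0] and [g] in
   [ker (T - nu)] bounds the form from below by
   [- |(T - l) f|^2 / (l - nu) - |M(nu)| |G0 f|^2], which tends to 0 as
   [nu] tends to [-oo]. *)
Lemma form_ge0 (l : R) f : l < mu -> dom T f -> 0 <= form l f.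
Proof.
move=> lmu Tf; pose w := T f - l%:C *: f.
have low (nu : R) : nu < l -> - (rnorm w ^+ 2 / (l - nu))
    - C / ((mu - nu) `^ beta) * rnorm (G0 f) ^+ 2 <= form l f.
  move=> nul; have numu := lt_trans nul lmu.
  have [g gk g0E] := eigen_complement G0_lin (resolvent_onto (A0_onto numu)) Tf.
  have [Tg gE] := gk; have TF := linear_on_domB T_lin Tf Tg.
  have F0 : G0 (f - g) = 0 by rewrite (linear_onB G0_lin)// g0E subrr.
  (* Together with Green's identity this gives [2 rip w g + (l - nu) |g|^2 + rip (G0 f) (G1 g) <=
     form l f]. The first two terms are then bounded by completing the square. *)
  have := A0_ge (conj TF F0); rewrite /= (linear_onB T_lin)// gE => h1.
  have := green_rip Tf Tg; rewrite gE g0E ripZr => h2.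
  have := eigen_bound numu gk; rewrite g0E => h3.
  have h4 := rip_geN (G0 f) (G1 g).
  have s0 : 0 < l - nu by rewrite subr_gt0.
  have h5 : - (rnorm w ^+ 2 / (l - nu)) <= 2 * rip w g + (l - nu) * rnorm g ^+ 2.
    have := sqr_ge0 (rnorm (w + (l - nu)%:C *: g)); rewrite rnormD_sqr rnormZr ripZr.
    rewrite exprMn real_normK ?num_real// -mulNr ler_pdivrMr//; lra.
  have h6 : rnorm (G0 f) * rnorm (G1 g) <= C / (mu - nu) `^ beta * rnorm (G0 f) ^+ 2.
    rewrite expr2 mulrCA ler_wpM2l ?rnorm_ge0//.
  have h7 : l * rnorm (f - g) ^+ 2 <= mu * rnorm (f - g) ^+ 2.
    by rewrite ler_wpM2r ?sqr_ge0// ltW.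
  move: (rnorm w ^+ 2 / (l - nu)) (C / _ * _) h5 h6 => q1 q2 h5 h6.
  move: h1 h5 h7; rewrite /w /form rnormB_sqr !ripE -!ripxx => h1 h5 h7.
  rewrite (ripC g f) (ripC (G1 f)) in h1 h2 *.
  by lra.
apply/ler_addgt0Pr => e e0; rewrite -lerBlDr sub0r.
have n1 : 0 < rnorm (G0 f) ^+ 2 + 1 by rewrite ltr_wpDl ?sqr_ge0.
have e2 : 0 < e / 2 by rewrite divr_gt0.
(* So far to the left that each of the two error terms is at most [e / 2]. *)
have [nu nul nue] := decay_small (l - 2 * rnorm w ^+ 2 / e) (divr_gt0 e2 n1).
have w0 : 0 <= 2 * rnorm w ^+ 2 / e by rewrite divr_ge0 ?(ltW e0)// mulr_ge0// sqr_ge0.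
have nl : nu < l by lra.
apply: le_trans (low nu nl).
have h1 : rnorm w ^+ 2 / (l - nu) <= e / 2.
  rewrite ler_pdivrMr ?subr_gt0//.
  have : 2 * rnorm w ^+ 2 / e < l - nu by lra.
  by rewrite ltr_pdivrMr//; lra.
have h2 : C / (mu - nu) `^ beta * rnorm (G0 f) ^+ 2 <= e / 2.
  move: nue; rewrite ltr_pdivlMr// mulrDr => h.
  have := decay_gt0 (lt_trans nl lmu); lra.
by lra.
Qed.

(** Non-negativity of the form at [f - g], where Green's identity reduces the mixed terms to
    [2 (G0 g, G1 f)]. The supremum of the left side over [g] is, formally,
    [(M(l)^-1 G1 f, G1 f)]. *)
Lemma form_eigen_le (l : R) f g : l < mu -> dom T f -> eigen_ker T l%:C g ->
  2 * rip (G0 g) (G1 f) - rip (G0 g) (G1 g) <= form l f.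
Proof.
move=> lmu Tf [Tg gE].
have := form_ge0 lmu (linear_on_domB T_lin Tf Tg).
rewrite /form (linear_onB T_lin)// (linear_onB G0_lin)// (linear_onB G1_lin)// gE.
have := green_rip Tf Tg; rewrite gE ripZr !ripE (ripC g f) (ripC (G1 f)).
by lra.
Qed.

Lemma weyl_ge0 (l : R) g : l < mu -> eigen_ker T l%:C g -> 0 <= rip (G0 g) (G1 g).
Proof.
move=> lmu [Tg gE]; have := form_ge0 lmu Tg.
by rewrite /form gE subrr rip0l add0r.
Qed.

(** Since [(M(l) phi, phi) <= K |phi|^2], the best test value is [phi = G1 f / K]. It is
    approximated by some [G0 g] with [g] in [ker (T - l)], at a loss of [K |phi - G0 g|^2 <= e]. *)
Lemma boundary1_bound (l : R) f : l < mu -> dom T f ->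
  rnorm (G1 f) ^+ 2 <= C / ((mu - l) `^ beta) * form l f.
Proof.
move=> lmu Tf; set K := C / _; have K0 : 0 < K by exact: decay_gt0.
rewrite -ler_pdivrMl//; apply/ler_addgt0Pr => e e0.
pose r := Num.min 1 (e / K); have r0 : 0 < r by rewrite lt_min ltr01 divr_gt0.
have [_ [g gk <-]] := (dense_rnormP _).1 (weyl_dense lmu) (K^-1%:C *: G1 f) _ r0.
set v := K^-1%:C *: G1 f => vg.
have := form_eigen_le lmu Tf gk.
have h1 : rip (G0 g) (G1 g) <= K * rnorm (G0 g) ^+ 2.
  apply: le_trans (rip_le _ _) _.
  by rewrite expr2 mulrCA ler_wpM2l ?rnorm_ge0// eigen_bound.
have h2 : rnorm (v - G0 g) ^+ 2 <= e / K.
  have r1 : r <= 1 by rewrite ge_min lexx.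
  have r2 : r <= e / K by rewrite ge_min lexx orbT.
  have := rnorm_ge0 (v - G0 g); nra.
have : K * rnorm (v - G0 g) ^+ 2 <= e by rewrite -ler_pdivlMl// mulrC.
rewrite rnormB_sqr /v rnormZr ripZl exprMn real_normK ?num_real// (ripC (G1 f)).
have -> : K * (K^-1 ^+ 2 * rnorm (G1 f) ^+ 2 - 2 * (K^-1 * rip (G0 g) (G1 f)) +
    rnorm (G0 g) ^+ 2) =
   K^-1 * rnorm (G1 f) ^+ 2 - 2 * rip (G0 g) (G1 f) + K * rnorm (G0 g) ^+ 2.
  by field; rewrite gt_eqF.
by lra.
Qed.

Section WeylClosure.
Variable l : R.
Hypothesis lmu : l < mu.
Let K := C / ((mu - l) `^ beta).
Local Notation M := (closure_op (weyl T G0 G1 l%:C)).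

Let M_graph x : closure (graph (weyl T G0 G1 l%:C)) (x, M x).
Proof.
have [|y xy] := dense_extension (K := K) (weyl_linear lmu) (weyl_dense lmu) _ x.
  exact: (opnorm_bound (weyl_linear lmu) (weyl_closable lmu) (M_decay lmu)).
by rewrite (closure_op_eq (weyl_linear lmu) (weyl_closable lmu) xy).
Qed.

Lemma weyl_closure_dom x : dom M x.
Proof. by exists (M x); exact: M_graph. Qed.

Lemma weyl_closureE g : eigen_ker T l%:C g -> M (G0 g) = G1 g.
Proof.
move=> gk; rewrite -(weylE lmu gk).
apply: (closure_op_eq (weyl_linear lmu) (weyl_closable lmu)).
by apply: closure_op_ext; exists g.
Qed.

Lemma weyl_closure_bound x : rnorm (M x) <= K * rnorm x.
Proof.
have b := opnorm_bound (weyl_linear lmu) (weyl_closable lmu) (M_decay lmu).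
exact: (closure_op_bound b (@M_graph x)).
Qed.

Lemma weyl_closure_sym x y : '[M x, y] = '[x, M y].
Proof.
have half g z : eigen_ker T l%:C g -> '[M z, G0 g] = '[z, G1 g].
  move=> gk; apply: inner_limit_left => e e0.
  have [_ [[f fk <-] h1 h2]] := (closure_graphP _ _ _).1 (@M_graph z) e e0.
  rewrite weylE// in h2.
  by exists (G1 f), (G0 f); split=> //; exact: weyl_sym fk gk.
rewrite innerC [RHS]innerC; congr (conjc _); apply/esym.
apply: inner_limit_left => e e0.
have [_ [[f fk <-] h1 h2]] := (closure_graphP _ _ _).1 (@M_graph y) e e0.
rewrite weylE// in h2; exists (G1 f), (G0 f); split=> //.
by rewrite innerC -half// -innerC.
Qed.

Lemma weyl_closure_ge0 x : 0 <= rip (M x) x.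
Proof.
apply/ler_addgt0Pr => e e0.
(* Replacing [x] by [G0 g = x - d] produces three error terms; [k] collects their coefficients of
   [|d|], given [|d| <= 1]. *)
pose k := rnorm (M x) + K * rnorm x + K + 1.
have K0 : 0 < K by exact: decay_gt0.
have k0 : 0 < k.
  by have := rnorm_ge0 (M x); have := rnorm_ge0 x; rewrite /k; nra.
pose r := Num.min 1 (e / k); have r0 : 0 < r by rewrite lt_min ltr01 divr_gt0.
have [_ [g gk <-] xg] := (dense_rnormP _).1 (weyl_dense lmu) x _ r0.
have := weyl_ge0 lmu gk; rewrite -(weyl_closureE gk) ripC.
have -> : G0 g = x - (x - G0 g) by rewrite opprB addrC subrK.
move: (x - G0 g) xg => d dr; rewrite (symmetric_sub weyl_closure_sym) ripBl !ripBr => h.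
have h1 := rip_geN (M x) d; have h2 := rip_geN (M d) x; have h3 := rip_le (M d) d.
have h4 := weyl_closure_bound d; have d0 := rnorm_ge0 d; have x0 := rnorm_ge0 x.
have h5 : rnorm (M d) * rnorm x <= K * rnorm d * rnorm x by rewrite ler_wpM2r.
have h6 : rnorm (M d) * rnorm d <= K * rnorm d * rnorm d by rewrite ler_wpM2r.
have d1 : rnorm d <= 1 by apply: le_trans (ltW dr) _; rewrite ge_min lexx.
have h7 : K * rnorm d * rnorm d <= K * rnorm d * 1 by rewrite ler_wpM2l// mulr_ge0// ltW.
have : k * rnorm d <= e.
  by rewrite mulrC -ler_pdivlMr// (le_trans (ltW dr))// ge_min lexx orbT.
by rewrite /k; lra.
Qed.

Lemma weyl_closure_form x : rip (M x) x <= K * rnorm x ^+ 2.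
Proof.
apply: le_trans (rip_le _ _) _.
by rewrite expr2 mulrA ler_wpM2r ?rnorm_ge0// weyl_closure_bound.
Qed.

End WeylClosure.

End Decay.

End Triple.

(** * Scalar estimates, where [X] stands for [|G1 f|^2] and [r] for [Re (A_[B] f, f)] at a unit
    vector [f] *)

Section RealEstimates.
Variables (R : realType) (beta C mu b r X : R).
Hypotheses (beta_gt0 : 0 < beta) (C_gt0 : 0 < C).
Hypothesis X_ge0 : 0 <= X.
Hypothesis X_le : forall l : R, l < mu -> X * (mu - l) `^ beta <= C * (r - l + b * X).

Let powE (t : R) : 0 < t -> t `^ beta * t `^ (1 - beta) = t.
Proof.
move=> t0; have c : (beta + (1 - beta) == 0) ==> (t != 0).
  by rewrite (gt_eqF t0) implybT.
by rewrite -(powRD c) addrC subrK powRr1// ltW.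
Qed.

Section Positive.
Hypothesis b_gt0 : 0 < b.
Let thr := mu - (C * b) `^ beta^-1.

Let Cb : 0 < C * b. Proof. exact: mulr_gt0. Qed.

Let thr_lt (l : R) : l < thr -> l < mu /\ C * b < (mu - l) `^ beta.
Proof.
rewrite /thr => h; have x0 := powR_gt0 beta^-1 Cb; split; first lra.
have xE : ((C * b) `^ beta^-1) `^ beta = C * b.
  by rewrite -powRrM mulVf ?gt_eqF// powRr1// ltW.
by rewrite -{1}xE; apply: gt0_ltr_powR; rewrite ?nnegrE//; lra.
Qed.

(** To the left of [thr] the number [(mu - l)^beta - C b] is positive, so [X_le] forces [l <= r];
    the midpoint of [r] and [thr] would violate this if [r < thr]. *)
Lemma thr_le_of_decay : thr <= r.
Proof.
rewrite leNgt; apply/negP => rt.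
have lt : (r + thr) / 2 < thr by lra.
have [lmu h] := thr_lt lt; have := X_le lmu.
have : X * (C * b) <= X * (mu - (r + thr) / 2) `^ beta by rewrite ler_wpM2l// ltW.
move=> h1 h2; have : 0 <= C * (r - (r + thr) / 2) by lra.
by rewrite pmulr_rge0//; lra.
Qed.

(* The point [l = 2 xi - r], at distance [r - xi] to the left of [xi]. *)
Lemma decay_positive (xi : R) : xi < thr ->
  X <= 2 * C / (1 - C * b / ((mu - xi) `^ beta)) * (r - xi) `^ (1 - beta).
Proof.
move=> xt; have [ximu xib] := thr_lt xt.
have t0 : 0 < r - xi by have := thr_le_of_decay; lra.
set q := (mu - xi) `^ beta in xib *; set t := r - xi in t0 *.
have q0 : 0 < q by apply: lt_trans xib.
have D0 : 0 < 1 - C * b / q by rewrite subr_gt0 ltr_pdivrMr// mul1r.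
set D := 1 - C * b / q in D0 *.
have lmu : xi - t < mu by lra.
have := X_le lmu; set P := (mu - (xi - t)) `^ beta => h.
have le_pow (u v : R) : 0 < u -> u <= v -> u `^ beta <= v `^ beta.
  move=> u0 uv; apply: ge0_ler_powR; rewrite ?nnegrE ?(ltW beta_gt0)// ltW//.
  exact: lt_le_trans uv.
have Pq : q <= P
  by apply: le_pow; [rewrite subr_gt0 | rewrite opprB addrA [mu + t]addrC -addrA lerDr ltW].
have Pt : t `^ beta <= P
  by apply: le_pow => //; rewrite opprB addrA [mu + t]addrC -addrA lerDl subr_ge0 ltW.
have D1 : 0 <= 1 - D by rewrite /D opprB addrC subrK divr_ge0// ltW.
have CbE : C * b = (1 - D) * q.
  by rewrite /D opprB addrC subrK divfK ?gt_eqF.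
(* Since [q <= P], the term [C b] is absorbed as [P - C b >= D P]; this is how the denominator of
   [K_xi] arises. *)
have CbP : C * b <= (1 - D) * P by rewrite CbE ler_wpM2l.
have h1 : X * (D * P) <= 2 * C * t.
  have : X * (C * b) <= X * ((1 - D) * P) by rewrite ler_wpM2l.
  move: h; rewrite /t; lra.
have h2 : X * (D * t `^ beta) <= X * (D * P).
  by rewrite ler_wpM2l// ler_wpM2l// ltW.
have tb : 0 < t `^ beta by rewrite powR_gt0.
rewrite mulrAC ler_pdivlMr// -(ler_pM2r tb).
have -> : 2 * C * t `^ (1 - beta) * t `^ beta = 2 * C * t.
  by rewrite -[in RHS](powE t0); ring.
by lra.
Qed.

End Positive.

Section Nonpositive.
Hypothesis b_le0 : b <= 0.

Lemma mu_le_of_decay : mu <= r.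
Proof.
rewrite leNgt; apply/negP => rmu; have lmu : (r + mu) / 2 < mu by lra.
have := X_le lmu; have : 0 <= X * (mu - (r + mu) / 2) `^ beta by rewrite mulr_ge0// powR_ge0.
have : b * X <= 0 by rewrite mulr_le0_ge0.
move=> h1 h2 h3; have : 0 <= C * (r - (r + mu) / 2 + b * X) by lra.
by rewrite pmulr_rge0//; lra.
Qed.

End Nonpositive.

Lemma decay_zero : b = 0 -> beta < 1 ->
  X <= C / (beta `^ beta * (1 - beta) `^ (1 - beta)) * (r - mu) `^ (1 - beta).
Proof.
move=> b0 beta1; have rmu : mu <= r by apply: mu_le_of_decay; rewrite b0.
have ob : 0 < 1 - beta by rewrite subr_gt0.
have XL (s : R) : 0 < s -> X * s `^ beta <= C * (r - mu + s).
  move=> s0; have lmu : mu - s < mu by rewrite gtrBl.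
  have := X_le lmu; rewrite b0 mul0r addr0.
  have -> : mu - (mu - s) = s by ring.
  by have -> : r - (mu - s) = r - mu + s by ring.
move: rmu; rewrite le_eqVlt => /predU1P[rE|rmu].
  rewrite -rE subrr powR0 ?gt_eqF// mulr0; apply/ler_addgt0Pr => e e0; rewrite add0r.
  (* Chosen so that [C s^(1 - beta) = e]: the case [r = mu] is a limit as [l] tends to [mu]. *)
  pose s := (e / C) `^ (1 - beta)^-1.
  have eC : 0 < e / C by rewrite divr_gt0.
  have s0 : 0 < s by exact: powR_gt0.
  have sE : s `^ (1 - beta) = e / C.
    by rewrite /s -powRrM mulVf ?gt_eqF// powRr1// ltW.
  have := XL s s0; rewrite -rE subrr add0r -{2}(powE s0) sE.
  have -> : C * (s `^ beta * (e / C)) = e * s `^ beta by field; rewrite gt_eqF.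
  by rewrite ler_pM2r// powR_gt0.
set t := r - mu; have t0 : 0 < t by rewrite subr_gt0.
(* The minimiser of [(t + s) / s^beta] over [s > 0], with [s = mu - l]. *)
pose s := beta * t / (1 - beta).
have s0 : 0 < s by rewrite divr_gt0// mulr_gt0.
have := XL s s0; rewrite -/t.
have -> : t + s = t / (1 - beta) by rewrite /s; field; rewrite gt_eqF.
have pb : 0 < beta `^ beta by exact: powR_gt0.
have pt : 0 < t `^ beta by exact: powR_gt0.
have po : 0 < (1 - beta) `^ beta by exact: powR_gt0.
have po' : 0 < (1 - beta) `^ (1 - beta) by exact: powR_gt0.
have -> : s `^ beta = beta `^ beta * t `^ beta / (1 - beta) `^ beta.
  rewrite /s powRM ?invr_ge0 ?mulr_ge0 ?ltW// powRM ?ltW//.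
  by rewrite -powR_inv1 ?ltW// -powRrM mulN1r powRN.
rewrite mulrA ler_pdivrMr// => h.
rewrite mulrAC ler_pdivlMr ?mulr_gt0// -(ler_pM2r pt) -(ler_pM2r po').
have -> : C * t `^ (1 - beta) * t `^ beta * (1 - beta) `^ (1 - beta) =
    C * t * (1 - beta) `^ (1 - beta) by rewrite -[in RHS](powE t0); ring.
have := ler_wpM2r (ltW (mulr_gt0 po' po')) h.
have -> : C * (t / (1 - beta)) * (1 - beta) `^ beta *
    ((1 - beta) `^ (1 - beta) * (1 - beta) `^ (1 - beta)) = C * t * (1 - beta) `^ (1 - beta).
  rewrite -{1}(powE ob); field; by rewrite !gt_eqF.
by lra.
Qed.

Lemma decay_zero1 : b = 0 -> beta = 1 -> X <= C.
Proof.
move=> b0 be1; have rmu : mu <= r by apply: mu_le_of_decay; rewrite b0.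
rewrite leNgt; apply/negP => CX; have d0 : 0 < X - C by rewrite subr_gt0.
(* Here [mu - l = s] is large: [s (X - C)] exceeds [C (r - mu)] by exactly [1]. *)
pose s := (C * (r - mu) + 1) / (X - C).
have s0 : 0 < s by rewrite divr_gt0// ltr_wpDl// mulr_ge0 ?subr_ge0// ltW.
have lmu : mu - s < mu by rewrite gtrBl.
have := X_le lmu; have -> : mu - (mu - s) = s by ring.
rewrite b0 be1 mul0r addr0 powRr1 ?(ltW s0)//.
have : s * (X - C) = C * (r - mu) + 1 by rewrite /s divfK ?gt_eqF.
by lra.
Qed.

Lemma decay_negative : b < 0 ->
  X <= 2 * C * (r - mu) / ((r - mu) `^ beta - C * b).
Proof.
move=> b0; have := mu_le_of_decay (ltW b0).
have Cb : 0 < - (C * b) by rewrite -mulrN mulr_gt0// oppr_gt0.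
rewrite le_eqVlt => /predU1P[rE|rmu].
  rewrite -rE subrr mulr0 mul0r; apply/ler_addgt0Pr => e e0; rewrite add0r.
  have [s s0 sE] : exists2 s, 0 < s & C * s = e * - (C * b).
    exists (e * - (C * b) / C); first by rewrite divr_gt0// mulr_gt0.
    by rewrite mulrC divfK ?gt_eqF.
  have lmu : mu - s < mu by rewrite gtrBl.
  have := X_le lmu; have : 0 <= X * (mu - (mu - s)) `^ beta by rewrite mulr_ge0// powR_ge0.
  by rewrite -rE => h1 h2; rewrite -(ler_pM2r Cb); lra.
have t0 : 0 < r - mu by rewrite subr_gt0.
(* The reflection of [r] in [mu]; then [r - l = 2 (r - mu)], the source of the factor [2]. *)
have lmu : mu - (r - mu) < mu by lra.
have := X_le lmu; have -> : mu - (mu - (r - mu)) = r - mu by ring.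
move=> h.
by rewrite ler_pdivlMr ?addr_gt0 ?powR_gt0//; lra.
Qed.

End RealEstimates.

Lemma decay_constant (R : realType) (beta c : R) : 0 < beta -> beta < 1 -> 0 <= c ->
  c <= c / (beta `^ beta * (1 - beta) `^ (1 - beta)) <= 2 * c.
Proof.
move=> b0 b1 c0; have o0 : 0 < 1 - beta by rewrite subr_gt0.
set p := beta `^ beta; set q := (1 - beta) `^ (1 - beta).
have p0 : 0 < p by exact: powR_gt0.
have q0 : 0 < q by exact: powR_gt0.
have le1 (x : R) : 0 < x -> x <= 1 -> x `^ x <= 1.
  by move=> x0 x1; rewrite -[leRHS](powRr0 x) ger_powR ?x0// ltW.
have p1 : p <= 1 by apply: le1 => //; exact: ltW.
have q1 : q <= 1 by apply: le1 => //; rewrite gerBl ltW.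
have pq0 : 0 < p * q by exact: mulr_gt0.
apply/andP; split.
  by rewrite ler_pdivlMr// ler_piMr// mulr_ile1// ltW.
rewrite ler_pdivrMr//.
suff : 1 <= 2 * (p * q) by move=> h; have := ler_wpM2l c0 h; lra.
(* Young's inequality for the exponents [1 / beta] and [1 / (1 - beta)]. *)
have powV (x : R) : 0 < x -> ((x `^ x)^-1) `^ x^-1 = x^-1.
  by move=> x0; rewrite -powRN -powRrM mulNr divff ?gt_eqF// powR_inv1// ltW.
have e1 : beta^-1^-1 + (1 - beta)^-1^-1 = 1 by rewrite !invrK addrC subrK.
have [pi qi] : 0 <= p^-1 /\ 0 <= q^-1 by rewrite !invr_ge0 !ltW.
have [bi oi] : 0 < beta^-1 /\ 0 < (1 - beta)^-1 by rewrite !invr_gt0.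
have := conjugate_powR pi qi bi oi e1.
rewrite !powV// !invrK !mulVf ?gt_eqF//.
move=> h; have := ler_wpM2r (ltW pq0) h.
have -> : p^-1 / q * (p * q) = 1 by field; rewrite !gt_eqF.
by lra.
Qed.

(** * Robin-type extensions *)

Section Robin.
Variables (R : realType) (H G : hilbertType R) (S T : op H H) (G0 G1 : H -> G).
Hypothesis triple : quasi_boundary_triple T G0 G1 S.

Let T_lin := qbt_linear triple.
Let G0_lin := qbt_linear0 triple.
Let G1_lin := qbt_linear1 triple.
Local Notation A0 := (ker_restrict T G0).
Local Notation A1 := (ker_restrict T G1).

Variables (mu beta C : R).
Hypothesis A0_onto : forall l : R, l < mu -> resolvent_set A0 l%:C.
Hypothesis A0_ge : forall f, dom A0 f -> mu * rnorm f ^+ 2 <= rip (A0 f) f.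
Hypotheses (beta_gt0 : 0 < beta) (C_gt0 : 0 < C).
Hypothesis M_decay : forall l : R, l < mu ->
  (opnorm (closure_op (weyl T G0 G1 l%:C)) <= (C / ((mu - l) `^ beta))%:E)%E.

Variables (B : op G G) (b : R).
Hypothesis B_lin : linear_op B.
Hypothesis B_i : forall x, dom B x -> rip (B x) x <= b * rnorm x ^+ 2.
Local Notation AB := (robin_op T G0 G1 B).

Lemma robin_linear : linear_op AB.
Proof.
split.
  split; first exact: (linear_on_dom0 T_lin).
  rewrite /= (linear_on0 G0_lin) (linear_on0 G1_lin) (linear_on0 B_lin).
  by split=> //; exact: (linear_on_dom0 B_lin).
move=> a f g [Tf [/= Bf fE]] [Tg [/= Bg gE]]; split; last exact: (linear_onP T_lin).
split; first exact: (linear_on_domP T_lin).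
rewrite /= (linear_onP G0_lin)// (linear_onP G1_lin)// fE gE; split.
  exact: (linear_on_domP B_lin).
by rewrite (linear_onP B_lin).
Qed.

Lemma robin_form l f : dom AB f ->
  form T G0 G1 l f = rip (T f) f - l * rnorm f ^+ 2 + rip (B (G1 f)) (G1 f).
Proof. by move=> [Tf [/= Bf fE]]; rewrite /form fE ripBl ripZl ripxx. Qed.

Lemma robin_Im f : dom AB f ->
  complex.Im '[T f, f] = - complex.Im '[B (G1 f), G1 f].
Proof.
move=> [Tf [/= Bf fE]]; have := qbt_green triple Tf Tf.
rewrite fE (innerC f (T f)) (innerC (G1 f)).
case: '[T f, f] '[B (G1 f), G1 f] => [x y] [x' y'] [] /=; lra.
Qed.

(** The family of inequalities that feeds all three enclosures: the bound on [G1 f], with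
    [Re (B x, x)] estimated by hypothesis (i). *)
Lemma robin_decay f : dom AB f -> rnorm f = 1 -> forall l : R, l < mu ->
  rnorm (G1 f) ^+ 2 * (mu - l) `^ beta <=
  C * (rip (T f) f - l + b * rnorm (G1 f) ^+ 2).
Proof.
move=> ABf f1 l lmu; have [Tf [/= Bf fE]] := ABf.
have pl : 0 < (mu - l) `^ beta by rewrite powR_gt0// subr_gt0.
have := boundary1_bound triple A0_onto A0_ge beta_gt0 C_gt0 M_decay lmu Tf.
rewrite mulrAC ler_pdivlMr// (robin_form l ABf) f1 expr1n mulr1 => /le_trans; apply.
rewrite ler_pM2l//; have := B_i Bf; lra.
Qed.

Section Sectorial.
Hypothesis B_closable : closable B.
Variable c1 : R.
Hypothesis A1_sa : self_adjoint A1.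
Hypothesis A1_ge : forall f, dom A1 f -> c1 * rnorm f ^+ 2 <= rip (A1 f) f.
Hypothesis B_ii : forall l : R, l < mu ->
  ran (sqrt_op (closure_op (weyl T G0 G1 l%:C))) `<=` dom B.
Hypothesis B_iii : forall l : R, l < mu ->
  img B (ran (closure_op (weyl T G0 G1 l%:C))) `<=` G0 @` dom T.
Hypothesis B_iv : G1 @` dom T `<=` dom B.

Section Fixed.
Variable l : R.
Hypotheses (lmu : l < mu) (lc1 : l < c1).
Let K := C / ((mu - l) `^ beta).
Hypothesis bK : `|b| * K < 1.
(** The coercivity constant of [1 - Q B Q], and also the share of the form that is left after
    [rip (B (G1 f)) (G1 f)] is subtracted. *)
Let d := 1 - `|b| * K.
Let M := closure_op (weyl T G0 G1 l%:C).
Let Q := sqrt_op M.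

Let K_gt0 : 0 < K. Proof. exact: decay_gt0. Qed.
Let d_gt0 : 0 < d. Proof. by rewrite subr_gt0. Qed.

Let Q_prop : [/\ forall x, dom Q x, forall x y, '[Q x, y] = '[x, Q y]
  & forall x, Q (Q x) = M x].
Proof.
apply: (sqrt_opP K_gt0).
- exact: (weyl_closure_dom triple A0_onto A0_ge M_decay lmu).
- exact: (weyl_closure_sym triple A0_onto A0_ge M_decay lmu).
- exact: (weyl_closure_ge0 triple A0_onto A0_ge beta_gt0 C_gt0 M_decay lmu).
- exact: (weyl_closure_form triple A0_onto A0_ge M_decay lmu).
Qed.

Let Q_sym : forall x y, '[Q x, y] = '[x, Q y]. Proof. by case: Q_prop. Qed.
Let QQ x : Q (Q x) = M x. Proof. by case: Q_prop. Qed.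
Let domBQ x : dom B (Q x).
Proof. by apply: (B_ii lmu); exists x => //; case: Q_prop. Qed.

Let Q_norm x : rnorm (Q x) ^+ 2 <= K * rnorm x ^+ 2.
Proof.
rewrite -ripxx (symmetric_rip Q_sym) QQ ripC.
exact: (weyl_closure_form triple A0_onto A0_ge M_decay lmu).
Qed.

Let Q_bound x : rnorm (Q x) <= (K + 1) * rnorm x.
Proof.
rewrite -(ler_pXn2r (ltn0Sn 1)) ?nnegrE ?mulr_ge0 ?rnorm_ge0 ?addr_ge0 ?(ltW K_gt0)//.
apply: le_trans (Q_norm x) _; rewrite exprMn ler_wpM2r ?sqr_ge0//.
by have := K_gt0; nra.
Qed.

(** [B Q] is everywhere defined by hypothesis (ii). As [Q] is bounded, [x -> 0] implies [Q x -> 0],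
    so closability passes from [B] to [B Q]. *)
Let BQ_bounded : exists c : R, forall x, rnorm (B (Q x)) <= c * rnorm x.
Proof.
apply: (@closed_graph_bounded R G G (fun x => B (Q x))) => [x y|t x|y yP].
- by rewrite (symmetric_sub Q_sym) (linear_onB B_lin).
- by rewrite (symmetric_scale Q_sym) (linear_onZ B_lin).
- apply: B_closable; apply/closure_graphP => e e0.
  have k0 : 0 < K + 1 by rewrite addr_gt0.
  have [x xe yx] := yP _ (divr_gt0 e0 (ltr_wpDl (ltW k0) ltr01)).
  have ke : e / (K + 1 + 1) * (K + 1) <= e.
    by rewrite mulrAC ler_pdivrMr ?ltr_wpDl// ?(ltW k0)// ler_pM2l// lerDl.
  exists (Q x); split=> //.
    rewrite sub0r rnormN; apply: le_lt_trans (Q_bound x) _; apply: lt_le_trans ke.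
    by rewrite mulrC ltr_pM2r.
  apply: lt_le_trans yx _; rewrite ler_pdivrMr ?ltr_wpDl ?(ltW k0)//.
  by rewrite ler_peMr ?(ltW e0)// lerDr ltW.
Qed.

Let robin_lower f : dom AB f ->
  d * form T G0 G1 l f <= rip (T f) f - l * rnorm f ^+ 2.
Proof.
move=> ABf; have [Tf [/= Bf fE]] := ABf.
have h := robin_form l ABf; have h1 := B_i Bf.
have := boundary1_bound triple A0_onto A0_ge beta_gt0 C_gt0 M_decay lmu Tf.
rewrite -/K => h2.
have h3 : b * rnorm (G1 f) ^+ 2 <= `|b| * rnorm (G1 f) ^+ 2.
  by rewrite ler_wpM2r ?sqr_ge0// ler_norm.
have h4 : `|b| * rnorm (G1 f) ^+ 2 <= `|b| * (K * form T G0 G1 l f).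
  by rewrite ler_wpM2l.
by rewrite /d mulrBl mul1r; lra.
Qed.

(* For real [l' < mu] the form at [l'] is the one at [l] minus
   [(l' - l) |f|^2], and it is still non-negative. *)
Let form_lower f : dom AB f -> (mu - l) / 2 * rnorm f ^+ 2 <= form T G0 G1 l f.
Proof.
move=> ABf; have [Tf _] := ABf.
have l'mu : (mu + l) / 2 < mu by have := lmu; lra.
have := form_ge0 triple A0_onto A0_ge beta_gt0 C_gt0 M_decay l'mu Tf.
by rewrite !(robin_form _ ABf); lra.
Qed.

Let A1_onto : onto A1 l%:C.
Proof. exact: (self_adjoint_surjective A1_sa A1_ge lc1). Qed.

Let robin_Im_bound : exists2 c : R, 0 <= c & forall f, dom AB f ->
  `|complex.Im '[T f, f]| <= c * form T G0 G1 l f.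
Proof.
have [c cP] := BQ_bounded; exists (`|c| * (K + 1)).
  by rewrite mulr_ge0// addr_ge0// ltW.
move=> f ABf; have [Tf [/= Bf fE]] := ABf.
have [g gk gE] := eigen_complement triple G1_lin A1_onto Tf.
(* Because [G1 g = G1 f], the left side collapses to [(M phi, phi) = |Q phi|^2] with
   [phi = G0 g]. *)
have := form_eigen_le triple A0_onto A0_ge beta_gt0 C_gt0 M_decay lmu Tf gk.
rewrite -gE; set F := form _ _ _ _ _ => hF.
have ME : M (G0 g) = G1 g by exact: (weyl_closureE triple A0_onto A0_ge lmu gk).
pose h := Q (G0 g); have hE : Q h = G1 f by rewrite /h QQ ME gE.
have hn : rnorm h ^+ 2 <= F.
  by rewrite -ripxx /h (symmetric_rip Q_sym) QQ ME; lra.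
rewrite (robin_Im ABf) -hE normrN Im_inner.
apply: le_trans (rip_norm_le _ _) _; rewrite rnormZi.
apply: (@le_trans _ _ ((`|c| * rnorm h) * ((K + 1) * rnorm h))).
  rewrite ler_pM ?rnorm_ge0//; apply: le_trans (cP h) _.
  by rewrite ler_wpM2r ?rnorm_ge0// ler_norm.
have -> : `|c| * rnorm h * ((K + 1) * rnorm h) = `|c| * (K + 1) * rnorm h ^+ 2 by ring.
by rewrite ler_wpM2l// mulr_ge0// addr_ge0// ltW.
Qed.

(* With [h - Q B Q h = Q y] and [phi = y + B Q h] one has [Q phi = h], hence
   [phi = y + B M phi]. *)
Let robin_onto : onto AB l%:C.
Proof.
(* The solution is sought as [f0 + g2] with [g2] in [ker (T - l)]. For [phi = G0 g2] the boundary
   condition reads [phi = B (G1 f0 + M phi)]. *)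
move=> g; have [f0 [Tf0 /= G0f0] f0E] := resolvent_onto (A0_onto lmu) g.
(* Writing [G1 f0] as [M (G0 g1)] gives [phi] the form [B (M _)], so that hypothesis (iii) places it
   in [ran G0]. *)
have [g1 g1k g1E] := eigen_complement triple G1_lin A1_onto Tf0.
have Bf0 : dom B (G1 f0) by apply: B_iv; exists f0.
pose y := B (G1 f0); pose E h := h - Q (B (Q h)).
have [c cP] := BQ_bounded.
have [|||h hE] := @coercive_surjective R G E (1 + (K + 1) * c) d _ _ d_gt0 _ (Q y).
- move=> u v; rewrite /E (symmetric_sub Q_sym) (linear_onB B_lin)// (symmetric_sub Q_sym).
  by apply: rip_ext => z; rewrite !ripE; ring.
- move=> x; apply: le_trans (ler_rnormD _ _) _; rewrite rnormN mulrDl mul1r lerD2l.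
  apply: le_trans (Q_bound _) _; rewrite -mulrA ler_wpM2l// addr_ge0// ltW//.
- move=> x; rewrite /E ripBl ripxx (symmetric_rip Q_sym).
  have h1 := B_i (domBQ x); have h2 := Q_norm x.
  have h3 : b * rnorm (Q x) ^+ 2 <= `|b| * (K * rnorm x ^+ 2).
    apply: (@le_trans _ _ (`|b| * rnorm (Q x) ^+ 2)); last exact: ler_wpM2l.
    by rewrite ler_wpM2r ?sqr_ge0// ler_norm.
  by rewrite /d mulrBl mul1r; lra.
pose phi := y + B (Q h).
have Qphi : Q phi = h.
  by rewrite /phi (symmetric_add Q_sym) -hE /E subrK.
have MQ : Q h = M phi by rewrite -Qphi QQ.
have MD := symmetric_add (weyl_closure_sym triple A0_onto A0_ge M_decay lmu).
have Mg1 : M (G0 g1) = G1 f0.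
  by rewrite -g1E; exact: (weyl_closureE triple A0_onto A0_ge lmu g1k).
have BMphi : dom B (M phi) by rewrite -MQ.
have phiE : phi = B (M (G0 g1 + phi)).
  by rewrite /M MD -/M Mg1 (linear_onD B_lin)// -MQ.
have [f' Tf' f'E] : (G0 @` dom T) phi.
  apply: (B_iii lmu); exists (M (G0 g1 + phi)) => //; split.
    exists (G0 g1 + phi) => //.
    exact: (weyl_closure_dom triple A0_onto A0_ge M_decay lmu).
  by rewrite /M MD -/M Mg1; exact: (linear_on_domD B_lin).
have [g2 g2k g2E] := eigen_complement triple G0_lin (resolvent_onto (A0_onto lmu)) Tf'.
have [Tg2 Tg2E] := g2k.
have G1g2 : G1 g2 = M phi.
  by rewrite -f'E -g2E; apply/esym/(weyl_closureE triple A0_onto A0_ge lmu g2k).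
exists (f0 + g2).
  split; first exact: (linear_on_domD T_lin).
  rewrite /= (linear_onD G1_lin)// (linear_onD G0_lin)// G0f0 add0r G1g2; split.
    exact: (linear_on_domD B_lin).
  by rewrite g2E f'E (linear_onD B_lin)// -MQ.
rewrite /= (linear_onD T_lin)// Tg2E scalerDr opprD addrACA subrr addr0.
exact: f0E.
Qed.

Lemma robin_sectorial : m_sectorial AB.
Proof.
have [c c0 Im_le] := robin_Im_bound.
pose m := d * ((mu - l) / 2).
have m0 : 0 < m by rewrite mulr_gt0// divr_gt0// subr_gt0.
have low f : dom AB f -> m * rnorm f ^+ 2 <= rip (T f) f - l * rnorm f ^+ 2.
  move=> ABf; apply: le_trans (robin_lower ABf).
  by rewrite -mulrA ler_pM2l//; exact: form_lower.
(* The real parts are at least [l + m]. A vertex halfway keeps [l] outside the sector, while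
   [Re z - l] is at most twice the distance of [Re z] to the vertex; hence the factor [2]. The [+ 1]
   makes the slope positive. *)
exists (l + m / 2), (2 * c / d + 1); split.
- by rewrite ltr_wpDl// divr_ge0 ?(ltW d_gt0)// mulr_ge0.
- move=> _ [f [ABf /= f1] <-].
  have := low f ABf; rewrite f1 expr1n !mulr1 => h1.
  have := robin_lower ABf; rewrite f1 expr1n mulr1 => h2.
  have h3 := Im_le f ABf.
  change (complex.Re '[T f, f]) with (rip (T f) f).
  have h4 : form T G0 G1 l f <= (rip (T f) f - l) / d by rewrite ler_pdivlMr// mulrC.
  have h5 : c * form T G0 G1 l f <= c * ((rip (T f) f - l) / d) by rewrite ler_wpM2l.
  split; first lra.
  apply: le_trans h3 _; apply: le_trans h5 _.
  have -> : c * ((rip (T f) f - l) / d) = c / d * (rip (T f) f - l) by ring.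
  have cd : 0 <= c / d by rewrite divr_ge0// ltW.
  have half (q u v : R) : 0 <= q -> 0 < u -> u <= v -> q * v <= (2 * q + 1) * (v - u / 2).
    by move=> q0 u0 uv; have : 0 <= q * (v - u) by [rewrite mulr_ge0// subr_ge0]; lra.
  have -> : rip (T f) f - (l + m / 2) = rip (T f) f - l - m / 2 by ring.
  by have -> : 2 * c / d = 2 * (c / d) by [ring]; exact: half.
- exists l%:C; split.
    by move=> [/= h _]; move: h; rewrite gerDl leNgt divr_gt0.
  apply: (onto_resolvent robin_linear m0 _ robin_onto) => f ABf.
  have := low f ABf; have := rip_le (T f - l%:C *: f) f; rewrite ripBl ripZl ripxx.
  have := rnorm_ge0 f; rewrite le_eqVlt => /predU1P[<- _ _|f0 h1 h2].
    by rewrite mulr0 rnorm_ge0.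
  by rewrite -(ler_pM2r f0); apply: le_trans h1; rewrite -mulrA -expr2.
Qed.

End Fixed.

Lemma robin_m_sectorial : m_sectorial AB.
Proof.
have b0 : 0 < `|b| + 1 by rewrite ltr_wpDl.
have e0 : 0 < (`|b| + 1)^-1 by rewrite invr_gt0.
have [l lc h] := @decay_small R mu beta C beta_gt0 C_gt0 (Num.min mu c1) _ e0.
move: lc; rewrite lt_min => /andP[lmu lc1].
apply: (robin_sectorial lmu lc1).
have K0 : 0 < C / ((mu - l) `^ beta) by exact: decay_gt0.
rewrite -(ltr_pM2r b0) mulVf ?gt_eqF// in h.
by apply: le_lt_trans h; rewrite mulrDr mulr1 mulrC lerDl ltW.
Qed.

End Sectorial.

End Robin.

(** * The imaginary part of [B] *)

Section ImaginaryPart.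
Variables (R : realType) (G : hilbertType R) (B : op G G).
Hypothesis B_lin : linear_op B.
Hypothesis B_dense : densely_defined B.

Lemma adjoint_linear : linear_op (adjoint B).
Proof.
split.
  by exists 0 => x Bx; apply: inner_eqP; rewrite ?scaler0 !rip0r.
move=> a x y xd yd; apply: adjoint_eq => // z Bz.
by rewrite !innerDr !innerZr !adjoint_inner.
Qed.

Let Im_opE x : Im_op B x = (2%:R * 'i)^-1 *: (B x - adjoint B x).
Proof. by []. Qed.

Lemma Im_op_linear : linear_op (Im_op B).
Proof.
have aB := adjoint_linear.
split.
  by split; [exact: (linear_on_dom0 B_lin) | exact: (linear_on_dom0 aB)].
move=> a x y [Bx aBx] [By aBy]; split.
  by split; [exact: (linear_on_domP B_lin) | exact: (linear_on_domP aB)].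
rewrite !Im_opE (linear_onP B_lin)// (linear_onP aB)// opprD addrACA -scalerBr.
by rewrite scalerDr !scalerA mulrC.
Qed.

Lemma Im_op_inner x : dom B x -> dom (adjoint B) x ->
  complex.Im '[B x, x] = rip (Im_op B x) x.
Proof.
move=> Bx aBx; rewrite /rip Im_opE innerZl innerBl (innerC (adjoint B x)).
rewrite -adjoint_inner//; move: '[B x, x] => z; rewrite subcJ.
suff -> : (2%:R * 'i)^-1 * (2%:R * (complex.Im z)%:C * 'i%C) = (complex.Im z)%:C :> R[i].
  by [].
have i0 : 'i != 0 :> R[i] by rewrite -complexiE eq_complex/= oner_eq0 andbF.
by rewrite complexiE; field.
Qed.

Lemma Im_inner_bound : dom B `<=` dom (adjoint B) -> bounded_op (Im_op B) ->
  0 <= fine (opnorm (closure_op (Im_op B))) /\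
  forall x, dom B x -> `|complex.Im '[B x, x]| <=
    fine (opnorm (closure_op (Im_op B))) * rnorm x ^+ 2.
Proof.
move=> BaB bI; have [n0 nP] := fine_opnorm_bound Im_op_linear bI; split=> // x Bx.
rewrite (Im_op_inner Bx (BaB _ Bx)); apply: le_trans (rip_norm_le _ _) _.
rewrite expr2 mulrA ler_wpM2r ?rnorm_ge0//.
by apply: nP; split=> //; exact: BaB.
Qed.

End ImaginaryPart.

Theorem theorem5p6 (R : realType) (H G : hilbertType R)
  (S T : op H H) (G0 G1 : H -> G)
  (S_linear : linear_op S) (S_dense : densely_defined S)
  (S_closed : closed_op S) (S_symmetric : symmetric_op S)
  (triple : quasi_boundary_triple T G0 G1 S)
  (A1_selfadj : self_adjoint (ker_restrict T G1))
  (A0_below : bounded_from_below (ker_restrict T G0))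
  (A1_below : bounded_from_below (ker_restrict T G1))
  (M_bounded : exists2 l : R[i], resolvent_set (ker_restrict T G0) l
                                 & bounded_op (weyl T G0 G1 l))
  (beta C mu : R) (beta_gt0 : 0 < beta) (beta_le1 : beta <= 1) (C_gt0 : 0 < C)
  (mu_le : (mu%:E <= min_spectrum (ker_restrict T G0))%E)
  (M_decay : forall l : R, l < mu ->
     (opnorm (closure_op (weyl T G0 G1 l%:C))
        <= (C / ((mu - l) `^ beta))%:E)%E)
  (B : op G G) (B_linear : linear_op B) (B_closable : closable B) (b : R)
  (B_i : forall x, dom B x -> complex.Re '[B x, x] <= b * rnorm x ^+ 2)
  (B_ii : forall l : R, (l%:E < min_spectrum (ker_restrict T G0))%E ->
     ran (sqrt_op (closure_op (weyl T G0 G1 l%:C))) `<=` dom B)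
  (B_iii : forall l : R, (l%:E < min_spectrum (ker_restrict T G0))%E ->
     img B (ran (closure_op (weyl T G0 G1 l%:C))) `<=` G0 @` dom T)
  (B_iv : G1 @` dom T `<=` dom B) :
  let AB := robin_op T G0 G1 B in
  let normImB : R := fine (opnorm (closure_op (Im_op B))) in
  [/\ m_sectorial AB,
      spectrum AB `<=` closure (numerical_range AB : set R[i]^o)
    & dom B `<=` dom (adjoint B) -> bounded_op (Im_op B) ->
      [/\ 0 < b ->
          forall xi : R, xi < mu - (C * b) `^ beta^-1 ->
          let K := 2 * C * normImB / (1 - C * b / ((mu - xi) `^ beta)) in
          forall z : R[i], numerical_range AB z ->
            mu - (C * b) `^ beta^-1 <= complex.Re z /\
            `|complex.Im z| <= K * (complex.Re z - xi) `^ (1 - beta),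
          b = 0 ->
          let K' := if beta < 1
                    then C * normImB / (beta `^ beta * (1 - beta) `^ (1 - beta))
                    else C * normImB in
          (forall z : R[i], numerical_range AB z ->
             mu <= complex.Re z /\
             `|complex.Im z| <= K' * (complex.Re z - mu) `^ (1 - beta)) /\
          C * normImB <= K' <= 2 * C * normImB
        & b < 0 ->
          forall z : R[i], numerical_range AB z ->
            mu <= complex.Re z /\
            `|complex.Im z| <= 2 * C * normImB * (complex.Re z - mu)
                               / ((complex.Re z - mu) `^ beta - C * b)]].
Proof.
have A0_sa := qbt_selfadj triple.
have below_min (l : R) : l < mu -> (l%:E < min_spectrum (ker_restrict T G0))%E.
  by move=> lmu; apply: lt_le_trans mu_le; rewrite lte_fin.
have A0_onto (l : R) : l < mu -> resolvent_set (ker_restrict T G0) l%:C.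
  move=> /below_min; apply: contraPP => ls; apply/negP; rewrite -leNgt.
  by apply: ereal_inf_lbound; exists l.
have [c0 A0c0] := bounded_from_belowP A0_below.
have A0_ge := self_adjoint_lower_bound A0_sa A0c0 A0_onto.
have [c1 A1_ge] := bounded_from_belowP A1_below.
move=> AB normImB.
have AB_sect : m_sectorial AB.
  apply: (robin_m_sectorial triple A0_onto A0_ge beta_gt0 C_gt0 M_decay
    B_linear B_i B_closable A1_selfadj A1_ge _ _ B_iv).
  - by move=> l lmu; exact: B_ii (below_min _ lmu).
  - by move=> l lmu; exact: B_iii (below_min _ lmu).
split=> //.
  exact: (spectrum_numerical_range (robin_linear triple B_linear)).
move=> BaB ImB.
have B_dense : densely_defined B.
  apply/dense_rnormP => x e e0.
  have [y /B_iv By xy] := (dense_rnormP _).1 (dense_boundary1 triple) x e e0.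
  by exists y.
have [n0 nP] := Im_inner_bound B_linear B_dense BaB ImB.
rewrite -/normImB in n0 nP.
(* From here on only [X = |G1 f|^2] and [Re z] enter, and the enclosures are statements about real
   numbers. *)
have W_P z : numerical_range AB z -> exists X : R, [/\ 0 <= X,
    forall l : R, l < mu -> X * (mu - l) `^ beta <= C * (complex.Re z - l + b * X)
  & `|complex.Im z| <= normImB * X].
  move=> [f [ABf f1] <-]; exists (rnorm (G1 f) ^+ 2); split; first exact: sqr_ge0.
    exact: (robin_decay triple A0_onto A0_ge beta_gt0 C_gt0 M_decay B_i ABf f1).
  have [_ [Bf _]] := ABf.
  by change (AB f) with (T f); rewrite (robin_Im triple ABf) normrN; exact: nP.
split.
- move=> b0 xi xit K z /W_P[X [X0 XP zX]].
  split; first exact: (thr_le_of_decay beta_gt0 C_gt0 X0 XP b0).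
  apply: le_trans zX _.
  have := ler_wpM2l n0 (decay_positive beta_gt0 C_gt0 X0 XP b0 xit).
  by move=> /le_trans; apply; rewrite /K le_eqVlt; apply/orP; left; apply/eqP; ring.
- move=> b0 K'; split=> [z /W_P[X [X0 XP zX]]|].
    split; first by apply: (mu_le_of_decay C_gt0 X0 XP); rewrite b0.
    apply: le_trans zX _; rewrite /K'; case: ltP => be.
      have := ler_wpM2l n0 (decay_zero beta_gt0 C_gt0 X0 XP b0 be).
      by move=> /le_trans; apply; rewrite le_eqVlt; apply/orP; left; apply/eqP; ring.
    have be1 : beta = 1 by apply/eqP; rewrite eq_le beta_le1.
    have := ler_wpM2l n0 (decay_zero1 C_gt0 X0 XP b0 be1).
    (* [powRr0] covers the base [0], in agreement with the convention [0^0 = 1] at [Re z = mu]. *)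
    by rewrite be1 subrr powRr0 mulr1 [C * normImB]mulrC.
  rewrite /K'; have Cn : 0 <= C * normImB by rewrite mulr_ge0// ltW.
  have -> : 2 * C * normImB = 2 * (C * normImB) by ring.
  case: ltP => be; first exact: decay_constant.
  by rewrite lexx; lra.
- move=> b0 z /W_P[X [X0 XP zX]].
  split; first exact: (mu_le_of_decay C_gt0 X0 XP (ltW b0)).
  apply: le_trans zX _.
  have := ler_wpM2l n0 (decay_negative C_gt0 X0 XP b0).
  by move=> /le_trans; apply; rewrite le_eqVlt; apply/orP; left; apply/eqP; ring.
Qed.
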